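(* For each $k=1,2,\dots,m$, the collection $\{E(\lambda^i)/G(c_i/r_k)\}_{i=0}^k$ gives a $q$-cell structure of $\pi'_{c/r_k}(P(\widetilde{X}_k))$. Moreover, $\{E(\lambda^i)/G(c_i/r_i)\}_{i=0}^m$ gives a $q$-cell structure of $\mathrm{WGr}(d,n)$, where $r_0=c_0$.
   Context: Fix integers $1\le d<n$, $W=(w_1,\dots,w_n)\in(\mathbb{Z}_{\ge 0})^n$ and an integer $a\ge 1$. Let $M_d(n,d)$ be the set of complex $n\times d$ matrices of rank $d$. For $A,B\in M_d(n,d)$ write $A\sim_w B$ if $B=\mathrm{diag}(t^{w_1},\dots,t^{w_n})\,A\,T$ for some $T\in \mathrm{GL}(d,\mathbb{C})$ and $t\in\mathbb{C}^*$ with $t^a=\det(T)$. Put $\mathrm{WGr}(d,n):=M_d(n,d)/\!\sim_w$ with the quotient topology. A Schubert symbol for $d<n$ is a sequence of integers $\lambda=(\lambda_1,\dots,\lambda_d)$ with $1\le\lambda_1<\cdots<\lambda_d\le n$; $\lambda\preceq\mu$ if $\lambda_j\le\mu_j$ for all $j$. Put $m:=\binom{n}{d}-1$ and fix a total order $\lambda^0<\cdots<\lambda^m$ on Schubert symbols preserving $\preceq$. Put $c_i:=a+\sum_{j=1}^d w_{\lambda^i_j}$ and $r_k:=\gcd\{c_0,\dots,c_k\}$ for $1\le k\le m$. For $A\in M_d(n,d)$ let $A_\lambda$ be the $d\times d$ matrix formed by rows $\lambda_1,\dots,\lambda_d$ of $A$, and let $P:M_d(n,d)\to\mathbb{C}^{m+1}\setminus\{0\}$,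 $P(A)=(\det A_{\lambda^0},\dots,\det A_{\lambda^m})$. Put $\widetilde{X}_k:=\{A\in M_d(n,d)\mid \det(A_{\lambda^j})=0\text{ for } j>k\}$; thus $P(\widetilde{X}_k)\subseteq\mathbb{C}^{k+1}\setminus\{0\}$ (first $k+1$ coordinates). For positive integers $b=(b_0,\dots,b_k)$, $\pi'_b:\mathbb{C}^{k+1}\setminus\{0\}\to\mathbb{W}P(b_0,\dots,b_k)$ is the quotient map by the $\mathbb{C}^*$-action $t(z_0,\dots,z_k)=(t^{b_0}z_0,\dots,t^{b_k}z_k)$; $\pi'_{c/r_k}$ is the case $b=(c_0/r_k,\dots,c_k/r_k)$. Let $\pi:M_d(n,d)\to\mathrm{Gr}(d,n)$ send a matrix to its column space, and let $E(\lambda)=\{X\in\mathrm{Gr}(d,n)\mid\dim(X\cap\mathbb{C}^{\lambda_j})=j,\ \dim(X\cap\mathbb{C}^{\lambda_j-1})=j-1,\ 1\le j\le d\}$, where $\mathbb{C}^k=\{(z_1,\dots,z_k,0,\dots,0)\}\subset\mathbb{C}^n$. $E(\lambda)$ is an open cell of complex dimension $\ell(\lambda)=\sum_j(\lambda_j-j)$. Let $G(c)$ denote the group of $c$-th roots of unity. $G(c_i)$ acts on $E(\lambda^i)$ by $t\cdot\pi(A)=\pi(\mathrm{diag}(t^{w_1},\dots,t^{w_n})A)$. If $r$ divides $c_0,\dots,c_i$, then $G(r)\subseteq G(c_i)$ acts trivially on $E(\lambda^i)$, and $G(c_i/r)\cong G(c_i)/G(r)$ (via $t\mapsto t^r$)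 acts on $E(\lambda^i)$ through this identification. A $q$-cell of dimension $k$ is the quotient of a $k$-disk by a linear action of a finite group $G$ (its interior being $\mathbb{R}^k/G$); a $q$-cell structure on a space $X$ is a filtration of $X$, starting with a point (or discrete set), in which each stage is obtained from the preceding one by attaching a $q$-cell $D^k/G$ along a continuous map from $S^{k-1}/G$. A collection of spaces ''gives a $q$-cell structure'' of $X$ if $X$ has a $q$-cell structure whose open $q$-cells are homeomorphic to the members of the collection. *)

(* Defs.v *)
From HB Require Import structures.
From mathcomp Require Import all_boot all_order all_algebra all_fingroup.
From mathcomp Require Import all_character.
From mathcomp Require Import generic_quotient complex.
From mathcomp Require Import all_classical all_reals all_analysis.

Set Implicit Arguments.
Unset Strict Implicit.
Unset Printing Implicit Defensive.

Import Order.TTheory GRing.Theory Num.Theory numFieldNormedType.Exports.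

Local Open Scope classical_set_scope.
Local Open Scope ring_scope.
Local Open Scope quotient_scope.

Definition homeomorphism (X Y : topologicalType) (f : X -> Y) : Prop :=
  continuous f /\
  exists g : Y -> X, [/\ continuous g, cancel f g & cancel g f].

Definition homeomorphic (X Y : topologicalType) : Prop :=
  exists f : X -> Y, homeomorphism f.

Definition pair_family (X Y : topologicalType) (b : bool) : topologicalType :=
  if b then X else Y.

Section Adjunction.
Variables (X Y : topologicalType) (A : set Y) (phi : A -> X).

(* The disjoint union of X (tag [true]) and Y (tag [false]). *)
Let XY : topologicalType := {b : bool & pair_family X Y b}.

Definition glue (p : XY) : XY :=
  match p with
  | existT true x => existT (pair_family X Y) true x
  | existT false y =>
      match pselect (y \in A) with
      | left Ay => existT (pair_family X Y) true (phi (exist _ y Ay))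
      | right _ => existT (pair_family X Y) false y
      end
  end.

(* The equivalence relation generated by y ~ phi y for y in A is the kernel of
   [glue]. *)
Definition adjunction_eq (p q : XY) : bool := `[< glue p = glue q >].

Lemma adjunction_eq_refl : reflexive adjunction_eq.
Proof. by move=> p; apply/asboolP. Qed.

Lemma adjunction_eq_sym : symmetric adjunction_eq.
Proof. by move=> p q; apply/asboolP/asboolP => ->. Qed.

Lemma adjunction_eq_trans : transitive adjunction_eq.
Proof. by move=> q p s /asboolP pq /asboolP qs; apply/asboolP; rewrite pq. Qed.

Canonical adjunction_equiv :=
  EquivRel adjunction_eq adjunction_eq_refl adjunction_eq_sym
    adjunction_eq_trans.

Definition adjunction : Type := quotient_topology {eq_quot adjunction_equiv}.

HB.instance Definition _ := Topological.on adjunction.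
HB.instance Definition _ := Quotient.on adjunction.

Definition adjunction_inl (x : X) : adjunction :=
  \pi_adjunction (existT (pair_family X Y) true x).

End Adjunction.

Section QDisk.
Variables (R : realType) (k : nat) (gT : finGroupType) (G : {group gT}).
Variable rG : mx_representation R G k.

Definition sqnorm (v : 'rV[R]_k) : R := \sum_i v 0 i ^+ 2.

Definition disk : set 'rV[R]_k := [set v | sqnorm v <= 1].

Definition disk_stable : Prop :=
  forall g v, g \in G -> disk v -> disk (v *m rG g).

Definition disk_orbit (u v : disk) : bool :=
  `[< exists2 g, g \in G & val v = val u *m rG g >].

Lemma disk_orbit_refl : reflexive disk_orbit.
Proof.
by move=> u; apply/asboolP; exists 1%g; rewrite ?group1// repr_mx1 mulmx1.
Qed.

Lemma disk_orbit_sym : symmetric disk_orbit.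
Proof.
have sym u v : disk_orbit u v -> disk_orbit v u.
  move=> /asboolP[g gG uv]; apply/asboolP.
  by exists g^-1%g; rewrite ?groupV// uv repr_mxK.
by move=> u v; apply/idP/idP; exact: sym.
Qed.

Lemma disk_orbit_trans : transitive disk_orbit.
Proof.
move=> v u t /asboolP[g gG uv] /asboolP[h hG vt]; apply/asboolP.
by exists (g * h)%g; rewrite ?groupM// vt uv repr_mxM// mulmxA.
Qed.

Canonical disk_orbit_equiv :=
  EquivRel disk_orbit disk_orbit_refl disk_orbit_sym disk_orbit_trans.

Definition qdisk : Type := quotient_topology {eq_quot disk_orbit_equiv}.

HB.instance Definition _ := Topological.on qdisk.
HB.instance Definition _ := Quotient.on qdisk.

(* S^(k-1)/G inside D^k/G; it is empty when k = 0. *)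
Definition qsphere : set qdisk :=
  \pi_qdisk @` [set v : disk | sqnorm (val v) = 1].

End QDisk.

Arguments qsphere {R k gT G} rG.

Section QCellStructure.
Variables (R : realType) (X : topologicalType).

(* B is obtained from A by attaching one q-cell D^k/G. *)
Definition attach_qcell (A B : set X) : Prop :=
  exists (k : nat) (gT : finGroupType) (G : {group gT})
         (rG : mx_representation R G k) (phi : qsphere rG -> A)
         (h : adjunction phi -> B),
    [/\ disk_stable rG, continuous phi, homeomorphism h &
        forall x : A, val (h (adjunction_inl phi x)) = val x].

(* Finite collections only involve filtrations with finitely many stages. *)
Definition qcell_structure (N : nat) (F : nat -> set X) : Prop :=
  [/\ forall U : set (F 0%N), open U,
      forall i, (i < N)%N -> attach_qcell (F i) (F i.+1) &
      F N = setT].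

Definition open_qcells (N : nat) (F : nat -> set X) : set (set X) :=
  [set [set x] | x in F 0%N] `|` [set F i.+1 `\` F i | i in `I_N].

Definition gives_qcell_structure (J : finType) (Y : J -> topologicalType) :
    Prop :=
  exists (N : nat) (F : nat -> set X),
    qcell_structure N F /\
    exists2 C : J -> set X, set_bij setT (open_qcells N F) C &
      forall j, homeomorphic (Y j) (C j).

End QCellStructure.

Arguments gives_qcell_structure R X {J} Y.

(* The field of complex numbers, with the topology of its absolute value. *)
Definition Cplx (R : realType) : numClosedFieldType := R[i].

Section FullRank.
Variables (R : realType) (n d : nat).
Local Notation C := (Cplx R).

Definition full_rank : set 'M[C]_(n, d) := [set A | \rank A = d].

Section WGr.
Variables (w : 'I_n -> nat) (a : nat).

Definition wdiag (t : C) : 'M[C]_n := diag_mx (\row_i t ^+ w i).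

Lemma wdiag1 : wdiag 1 = 1%:M.
Proof. by apply/matrixP => i j; rewrite !mxE expr1n. Qed.

Lemma wdiagM s t : wdiag (s * t) = wdiag s *m wdiag t.
Proof.
rewrite /wdiag mulmx_diag; congr diag_mx.
by apply/rowP => i; rewrite !mxE exprMn.
Qed.

Lemma wdiag_unit t : t != 0 -> wdiag t \in unitmx.
Proof.
move=> t0; have /mulmx1_unit[]// : wdiag t *m wdiag t^-1 = 1%:M.
by rewrite -wdiagM divff// wdiag1.
Qed.

Definition weq (A B : full_rank) : bool :=
  `[< exists (T : 'M[C]_d) (t : C),
        [/\ T \in unitmx, t != 0, t ^+ a = \det T &
            val B = wdiag t *m val A *m T] >].

Lemma weq_refl : reflexive weq.
Proof.
move=> A; apply/asboolP; exists 1%:M, 1.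
by rewrite unitmx1 oner_neq0 expr1n det1 wdiag1 mul1mx mulmx1.
Qed.

Lemma weq_sym : symmetric weq.
Proof.
have sym A B : weq A B -> weq B A.
  move=> /asboolP[T [t [uT t0 tT BE]]]; apply/asboolP; exists (invmx T), t^-1.
  rewrite unitmx_inv uT invr_eq0 t0 det_inv -tT exprVn BE; split => //.
  by rewrite !mulmxA -wdiagM mulVf// wdiag1 mul1mx mulmxK.
by move=> A B; apply/idP/idP; exact: sym.
Qed.

Lemma weq_trans : transitive weq.
Proof.
move=> B A D /asboolP[T [t [uT t0 tT BE]]] /asboolP[S [s [uS s0 sS DE]]].
apply/asboolP; exists (T *m S), (s * t).
rewrite unitmx_mul uT uS mulf_neq0// det_mulmx exprMn tT sS mulrC.
by split=> //; rewrite DE BE wdiagM !mulmxA.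
Qed.

Canonical weq_equiv := EquivRel weq weq_refl weq_sym weq_trans.

Definition WGr : Type := quotient_topology {eq_quot weq_equiv}.

HB.instance Definition _ := Topological.on WGr.
HB.instance Definition _ := Quotient.on WGr.

End WGr.

(* The column space of A is represented by the row space of A^T. *)
Definition same_colspace (A B : full_rank) : bool :=
  ((val A)^T == (val B)^T)%MS.

Lemma same_colspace_refl : reflexive same_colspace.
Proof. by move=> A; rewrite /same_colspace submx_refl. Qed.

Lemma same_colspace_sym : symmetric same_colspace.
Proof. by move=> A B; rewrite /same_colspace andbC. Qed.

Lemma same_colspace_trans : transitive same_colspace.
Proof.
by move=> B A D /andP[AB BA] /andP[BD DB];
  rewrite /same_colspace (submx_trans AB BD) (submx_trans DB BA).
Qed.

Canonical same_colspace_equiv :=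
  EquivRel same_colspace same_colspace_refl same_colspace_sym
    same_colspace_trans.

Definition Gr : Type := quotient_topology {eq_quot same_colspace_equiv}.

HB.instance Definition _ := Topological.on Gr.
HB.instance Definition _ := Quotient.on Gr.

(* Row indices, hence entries of Schubert symbols, are numbered from 0: the
   entry written l_j in 1..n is [(tnth (val l) j).+1]. *)
Definition schubert : Type :=
  {l : d.-tuple 'I_n | sorted ltn [seq val i | i <- l]}.

HB.instance Definition _ := Finite.on schubert.

Definition entry (l : schubert) (j : 'I_d) : 'I_n := tnth (val l) j.

Definition schubert_le (l l' : schubert) : Prop :=
  forall j, (entry l j <= entry l' j)%N.

(* dim (X \cap C^j); the rows of [pid_mx j] span C^j. *)
Definition dim_flag (X : Gr) (j : nat) : nat :=
  \rank ((val (repr X))^T :&: (pid_mx j : 'M[C]_n))%MS.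

Definition schubert_cell (l : schubert) : set Gr :=
  [set X | forall j : 'I_d, dim_flag X (entry l j).+1 = j.+1 /\
                            dim_flag X (entry l j) = j].

Section Action.
Variable w : 'I_n -> nat.

(* The default value of [insubd] is used only for t = 0. *)
Definition wscale (t : C) (A : full_rank) : full_rank :=
  insubd A (wdiag w t *m val A).

Definition gr_act (t : C) (X : Gr) : Gr := \pi_Gr (wscale t (repr X)).

Lemma val_wscale t A : t != 0 -> val (wscale t A) = wdiag w t *m val A.
Proof.
move=> t0; rewrite val_insubd; case: ifPn => // /negP[].
have /set_mem/= rA := valP A; apply/mem_set => /=.
by rewrite /full_rank/= -mxrank_tr trmx_mul mxrankMfree ?mxrank_tr//
  row_free_unit unitmx_tr wdiag_unit.
Qed.

Lemma gr_act_pi t A : t != 0 -> gr_act t (\pi_Gr A) = \pi_Gr (wscale t A).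
Proof.
move=> t0; apply/eqmodP; rewrite /= /same_colspace !val_wscale//.
have /eqmodP/andP[AB BA] : \pi_Gr (repr (\pi_Gr A)) = \pi_Gr A by rewrite reprK.
by rewrite !trmx_mul !submxMr.
Qed.

Lemma gr_act1 X : gr_act 1 X = X.
Proof.
rewrite -[X in RHS]reprK; congr \pi_Gr; apply: val_inj.
by rewrite val_wscale ?oner_neq0// wdiag1 mul1mx.
Qed.

Lemma gr_actM s t X : s != 0 -> t != 0 ->
  gr_act (s * t) X = gr_act s (gr_act t X).
Proof.
move=> s0 t0; rewrite [gr_act t X]/gr_act gr_act_pi//.
congr \pi_Gr; apply: val_inj.
by rewrite !val_wscale ?mulf_neq0// wdiagM mulmxA.
Qed.

Variables (c r : nat) (l : schubert).

(* The group G(c/r) of (c/r)-th roots of unity s acts on the cell as any c-th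
   root of unity t such that t^r = s; t != 0 is automatic for c > 0. *)
Definition cell_orbit (x y : schubert_cell l) : bool :=
  `[< exists s t : C, [/\ s ^+ (c %/ r) = 1, t != 0, t ^+ c = 1, t ^+ r = s &
        val y = gr_act t (val x)] >].

Lemma cell_orbit_refl : reflexive cell_orbit.
Proof.
move=> x; apply/asboolP; exists 1, 1.
by rewrite !expr1n oner_neq0 gr_act1.
Qed.

Lemma cell_orbit_sym : symmetric cell_orbit.
Proof.
have sym x y : cell_orbit x y -> cell_orbit y x.
  move=> /asboolP[s [t [s1 t0 t1 ts yE]]]; apply/asboolP; exists s^-1, t^-1.
  rewrite !exprVn s1 t1 ts invr1 invr_eq0; split=> //.
  by rewrite yE -gr_actM ?invr_eq0// mulVf// gr_act1.
by move=> x y; apply/idP/idP; exact: sym.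
Qed.

Lemma cell_orbit_trans : transitive cell_orbit.
Proof.
move=> y x z /asboolP[s [t [s1 t0 t1 ts yE]]].
move=> /asboolP[s' [t' [s1' t0' t1' ts' zE]]].
apply/asboolP; exists (s' * s), (t' * t).
rewrite !exprMn s1 s1' t1 t1' ts ts' mulf_neq0// mulr1.
by split=> //; rewrite zE yE gr_actM.
Qed.

Canonical cell_orbit_equiv :=
  EquivRel cell_orbit cell_orbit_refl cell_orbit_sym cell_orbit_trans.

(* E(l)/G(c/r) *)
Definition qcell : Type := quotient_topology {eq_quot cell_orbit_equiv}.

HB.instance Definition _ := Topological.on qcell.
HB.instance Definition _ := Quotient.on qcell.

End Action.

Section Pluecker.
Variables (m : nat) (lam : 'I_m.+1 -> schubert).

Definition cnum (w : 'I_n -> nat) (a : nat) (i : 'I_m.+1) : nat :=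
  (a + \sum_(j < d) w (entry (lam i) j))%N.

Definition rnum (w : 'I_n -> nat) (a : nat) (k : 'I_m.+1) : nat :=
  \big[gcdn/0%N]_(i < m.+1 | (i <= k)%N) cnum w a i.

Lemma rnum0 w a : rnum w a ord0 = cnum w a ord0.
Proof.
rewrite /rnum (bigD1 ord0)//= big1 ?gcdn0// => i /andP[].
by rewrite leqn0 -val_eqE => ->.
Qed.

Definition minor (A : 'M[C]_(n, d)) (i : 'I_m.+1) : C :=
  \det (rowsub (entry (lam i)) A).

Definition Xtilde (k : 'I_m.+1) : set full_rank :=
  [set A | forall j : 'I_m.+1, (k < j)%N -> minor (val A) j = 0].

End Pluecker.

End FullRank.

Arguments full_rank R n d : clear implicits.
Arguments Gr R n d : clear implicits.
Arguments WGr R {n} d w a.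
Arguments qcell R {n d} w c r l.

Section WeightedProjective.
Variables (R : realType) (k : nat).
Local Notation C := (Cplx R).

Definition nonzero_vec : set 'rV[C]_k.+1 := [set z | z != 0].

Section WP.
Variable b : 'I_k.+1 -> nat.

Definition wp_eq (z z' : nonzero_vec) : bool :=
  `[< exists2 t : C, t != 0 &
        forall i, val z' 0 i = t ^+ b i * val z 0 i >].

Lemma wp_eq_refl : reflexive wp_eq.
Proof.
by move=> z; apply/asboolP; exists 1; rewrite ?oner_neq0// => i;
  rewrite expr1n mul1r.
Qed.

Lemma wp_eq_sym : symmetric wp_eq.
Proof.
have sym z z' : wp_eq z z' -> wp_eq z' z.
  move=> /asboolP[t t0 zz']; apply/asboolP; exists t^-1; rewrite ?invr_eq0//.
  by move=> i; rewrite zz' exprVn mulKf ?expf_neq0.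
by move=> z z'; apply/idP/idP; exact: sym.
Qed.

Lemma wp_eq_trans : transitive wp_eq.
Proof.
move=> z' z z'' /asboolP[t t0 zz'] /asboolP[s s0 z'z'']; apply/asboolP.
exists (s * t); rewrite ?mulf_neq0// => i.
by rewrite z'z'' zz' exprMn mulrA.
Qed.

Canonical wp_equiv := EquivRel wp_eq wp_eq_refl wp_eq_sym wp_eq_trans.

Definition WP : Type := quotient_topology {eq_quot wp_equiv}.

HB.instance Definition _ := Topological.on WP.
HB.instance Definition _ := Quotient.on WP.

Definition wp_pi (z : nonzero_vec) : WP := \pi_WP z.

End WP.

End WeightedProjective.

Arguments nonzero_vec R k : clear implicits.
Arguments wp_pi {R k} b.

Section PlueckerImage.
Variables (R : realType) (n d m : nat) (lam : 'I_m.+1 -> schubert n d).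
Variable k : 'I_m.+1.

Definition inject (i : 'I_k.+1) : 'I_m.+1 := widen_ord (ltn_ord k) i.

Definition PXtilde : set (nonzero_vec R k) :=
  [set z : nonzero_vec R k | exists2 A : full_rank R n d, Xtilde lam k A &
           forall i, val z 0 i = minor lam (val A) (inject i)].

End PlueckerImage.

Arguments PXtilde R {n d m} lam k.

(* Main.v *)
(* Multiplying Pluecker coordinates by t^(c_j) identifies both spaces with the
   quotient of a union of Schubert cells by the relation "minor_j B = t^(c_j)
   minor_j A for all j".  Every orbit meets the sphere where the absolute values
   of the minors sum to 1 in an orbit of the circle, so the points whose last
   nonzero minor is the i-th one form the quotient of the Schubert cell E(lam_i)
   (matrices of norm 1 with positive i-th minor) by the c_i-th roots of unity;
   the divisor r of c_i plays no role.

   The characteristic map of the i-th cell is a Bott-Samelson map: a product of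
   matrices of SU(2) type acting on two consecutive rows, each depending on one
   complex parameter v in the closed unit disk, applied to a coordinate matrix.
   Its i-th minor is the product of the factors 1 - |v|, so it vanishes exactly
   on the boundary, and diagonal unitary matrices act on the parameters by
   phases, hence linearly.  The polydisk of parameters is an equivariant radial
   rescaling of the ball.  Weighted projective spaces are Hausdorff, so all the
   continuous bijections involved, which come from compact spaces, are
   homeomorphisms. *)
Require Import Defs.
From mathcomp Require Import all_boot all_order all_algebra all_fingroup.
From mathcomp Require Import cyclic separable cyclotomic.
From mathcomp Require Import all_character.
From mathcomp Require Import generic_quotient complex.
From mathcomp Require Import all_classical all_reals all_analysis.
From mathcomp Require Import zify ring lra.

Set Implicit Arguments.
Unset Strict Implicit.
Unset Printing Implicit Defensive.

Import Order.TTheory GRing.Theory Num.Theory numFieldNormedType.Exports.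

Local Open Scope classical_set_scope.
Local Open Scope ring_scope.
Local Open Scope quotient_scope.

(** The affine coordinates of a Schubert cell need not extend continuously to a closed disk; this is
    what calls for Bott-Samelson products.

    A chart is equivariant only up to a right factor [T], and weighted orbits are sensitive to
    [\det T]. The chart therefore records this determinant: together with [t ^+ c_i = 1] it turns
    phases on the parameters into multiplication of the j-th minor by [t ^+ c_j].

    Two points are topological. An open cell is not compact in general, and the orbit space of a
    Schubert cell has a quotient topology while the open q-cell has a subspace topology; both are
    compared through the closed disk. The group of nonzero scalars is not compact either, so
    separating orbits requires a bound on the scalars that relate nearby points. *)

Section Combinatorics.
Variables n d : nat.
Implicit Types (f g h : 'I_d -> 'I_n) (l : schubert n d).

(** These counts do not change when [f] is permuted, so unsorted choices of rows can be compared
    without sorting them. *)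
Definition cnt f (j : nat) : nat := #|[pred q | (f q < j)%N]|.

(* For injective f and g: the increasing rearrangement of g is entrywise at most
   that of f. *)
Definition cle g f : Prop := forall j, (cnt f j <= cnt g j)%N.

Definition repl f (q : 'I_d) (p : 'I_n) : 'I_d -> 'I_n :=
  fun i => if i == q then p else f i.

Lemma cle_trans g f h : cle f g -> cle g h -> cle f h.
Proof. by move=> fg gh j; exact: leq_trans (gh j) (fg j). Qed.

Lemma leq_cnt f j k : (j <= k)%N -> (cnt f j <= cnt f k)%N.
Proof.
by move=> jk; apply/subset_leq_card/fintype.subsetP => q; rewrite !inE => /leq_trans; exact.
Qed.

Lemma cle_pointwise f g : (forall q, f q <= g q)%N -> cle f g.
Proof.
move=> fg j; apply/subset_leq_card/fintype.subsetP => q; rewrite !inE.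
exact: leq_ltn_trans.
Qed.

Lemma cnt_perm f (s : {perm 'I_d}) j : cnt (f \o s) j = cnt f j.
Proof.
rewrite /cnt -(card_imset _ (@perm_inj _ s)); apply: eq_card => q.
rewrite !inE; apply/imsetP/idP => [[p + ->]|fq]; first by rewrite inE.
by exists ((s^-1)%g q); rewrite ?inE/= permKV.
Qed.

Lemma cnt_eq f g j : f =1 g -> cnt f j = cnt g j.
Proof. by move=> fg; apply: eq_card => q; rewrite !inE fg. Qed.

Lemma entry_lt l (i j : 'I_d) : (i < j)%N -> (entry l i < entry l j)%N.
Proof.
move=> ij; have := valP l; set s := map _ _ => ss.
have sz : size s = d by rewrite size_map size_tuple.
have sE (k : 'I_d) : entry l k = nth 0%N s k :> nat.
  by rewrite (nth_map (entry l k)) ?size_tuple// {1}/entry (tnth_nth (entry l k)).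
by rewrite !sE; have /(_ i j) := sorted_ltn_nth ltn_trans 0%N ss;
  rewrite !inE sz !ltn_ord; exact.
Qed.

Lemma entry_ltE l (i j : 'I_d) : (entry l i < entry l j)%N = (i < j)%N.
Proof.
apply/idP/idP; last exact: entry_lt.
rewrite !ltnNge; apply: contra; rewrite leq_eqVlt => /orP[/eqP/val_inj->//|ji].
by rewrite ltnW// entry_lt.
Qed.

Lemma entry_inj l : injective (entry l).
Proof.
move=> i j ij; apply/val_inj/eqP; rewrite eqn_leq.
by rewrite leqNgt -(entry_ltE l) ij ltnn leqNgt -(entry_ltE l) ij ltnn.
Qed.

Lemma card_ord_lt (q : nat) : (q <= d)%N -> #|[pred i : 'I_d | (i < q)%N]| = q.
Proof.
move=> qd; have wi : injective (widen_ord qd).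
  by move=> i j /(congr1 val)/= /val_inj.
rewrite -[RHS]card_ord -(card_imset _ wi); apply: eq_card => i; rewrite !inE.
apply/idP/imsetP => [iq|[j _ ->]/=]; last exact: ltn_ord.
by exists (Ordinal iq) => //; apply: val_inj.
Qed.

Lemma cnt_entry l (q : 'I_d) : cnt (entry l) (entry l q) = q.
Proof.
rewrite -[RHS](card_ord_lt (ltnW (ltn_ord q))); apply: eq_card => i.
by rewrite !inE entry_ltE.
Qed.

Lemma cnt_entryS l (q : 'I_d) : cnt (entry l) (entry l q).+1 = q.+1.
Proof.
rewrite -[RHS](card_ord_lt (ltn_ord q)); apply: eq_card => i.
by rewrite !inE !ltnS leqNgt entry_ltE -leqNgt.
Qed.

Lemma cle_entryP l l' : cle (entry l) (entry l') <-> schubert_le l l'.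
Proof.
split=> [ll' q|]; last exact: cle_pointwise.
rewrite leqNgt; apply/negP => lt.
have := leq_trans (ll' (entry l' q).+1) (leq_cnt (entry l) lt).
by rewrite cnt_entry cnt_entryS ltnn.
Qed.

Lemma schubert_le_anti l l' : schubert_le l l' -> schubert_le l' l -> l = l'.
Proof.
move=> ll' l'l; apply/val_inj/eq_from_tnth => q; apply/val_inj/eqP.
by rewrite eqn_leq ll' l'l.
Qed.

Lemma injective_schubert f : injective f ->
  exists l (s : {perm 'I_d}), f =1 entry l \o s.
Proof.
move=> fi; pose S := [set f q | q : 'I_d].
have sz : size (enum S) == d.
  by rewrite -cardE card_imset// card_ord.
have srt : sorted ltn [seq val i | i <- Tuple sz].
  rewrite /= -[enum _](eq_filter (mem_enum _)).
  rewrite -(eq_filter (mem_map val_inj _)) -filter_map.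
  by rewrite (sorted_filter ltn_trans) // unlock val_ord_enum iota_ltn_sorted.
pose l : schubert n d := exist _ (Tuple sz) srt.
have inl q : exists k, entry l k == f q.
  have /tnthP[k ->] : f q \in Tuple sz by rewrite mem_enum imset_f.
  by exists k.
have si : injective (fun q => xchoose (inl q)).
  move=> q r /(congr1 (entry l)).
  by rewrite (eqP (xchooseP (inl q))) (eqP (xchooseP (inl r))) => /fi.
exists l, (perm si) => q /=.
by rewrite permE (eqP (xchooseP (inl q))).
Qed.

(** Both functions sort to Schubert symbols with equal counts, and the entrywise order on symbols is
    antisymmetric; only the two sorting permutations remain. *)
Lemma cle_anti_perm f g : injective f -> injective g ->
  cle f g -> cle g f -> exists s : {perm 'I_d}, g =1 f \o s.
Proof.
move=> /injective_schubert[l [s fE]] /injective_schubert[l' [s' gE]] fg gf.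
have cf j : cnt f j = cnt (entry l) j by rewrite (cnt_eq _ fE) cnt_perm.
have cg j : cnt g j = cnt (entry l') j by rewrite (cnt_eq _ gE) cnt_perm.
have ll' : l = l'.
  by apply: schubert_le_anti; apply/cle_entryP => j; rewrite -cf -cg.
exists (s' * s^-1)%g => q; rewrite /= fE gE /= ll' permM.
by rewrite permKV.
Qed.

End Combinatorics.

(** * Minors and Schubert cells *)

Section Minors.
Variables (F : fieldType) (n d : nat).
Implicit Types (A B : 'M[F]_(n, d)) (f g h : 'I_d -> 'I_n) (l : schubert n d).

Definition pl A f : F := \det (rowsub f A).

(** The Schubert cell in terms of minors: [f] is the largest choice of rows with a nonzero minor.
    [incell_flagP] reconciles this with the dimension conditions. *)
Definition incell A f : Prop := pl A f != 0 /\ forall g, pl A g != 0 -> cle g f.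

Lemma eq_pl A f g : f =1 g -> pl A f = pl A g.
Proof. by move=> fg; congr (\det _); apply/matrixP => i j; rewrite !mxE fg. Qed.

Lemma pl_mulr A (T : 'M[F]_d) f : pl (A *m T) f = pl A f * \det T.
Proof. by rewrite /pl -det_mulmx mul_rowsub_mx. Qed.

(** Cauchy-Binet before grouping: all functions [h] are kept, which suffices to see which minors of
    [A] can contribute. *)
Lemma pl_mull (U : 'M[F]_n) A f :
  pl (U *m A) f = \sum_(h : {ffun 'I_d -> 'I_n}) (\prod_i U (f i) (h i)) * pl A h.
Proof.
rewrite /pl /determinant.
under eq_bigr do under eq_bigr do rewrite !mxE.
under eq_bigr do rewrite bigA_distr_bigA big_distrr /=.
rewrite exchange_big; apply: eq_bigr => h _; rewrite big_distrr/=.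
apply: eq_bigr => s _; rewrite big_split/= mulrCA; congr (_ * (_ * _)).
by apply: eq_bigr => i _; rewrite mxE.
Qed.

Lemma pl_diag (u : 'rV[F]_n) A f :
  pl (diag_mx u *m A) f = (\prod_i u 0 (f i)) * pl A f.
Proof.
rewrite /pl (_ : rowsub f _ = diag_mx (\row_i u 0 (f i)) *m rowsub f A).
  by rewrite det_mulmx det_diag; congr (_ * _); apply: eq_bigr => i _; rewrite mxE.
by rewrite !mul_diag_mx; apply/matrixP => i j; rewrite !mxE.
Qed.

Lemma pl_perm A f (s : {perm 'I_d}) : pl A (f \o s) = (-1) ^+ s * pl A f.
Proof.
rewrite /pl -det_perm -det_mulmx -row_permE; congr (\det _).
by apply/matrixP => i j; rewrite !mxE.
Qed.

Lemma pl_inj A f : pl A f != 0 -> injective f.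
Proof.
move=> pl0 i j fij; apply/eqP; apply: contraNT pl0 => ij; apply/eqP.
by apply: (determinant_alternate ij) => k; rewrite !mxE fij.
Qed.

Lemma pl_sort A f : pl A f != 0 -> exists l (s : {perm 'I_d}),
  f =1 entry l \o s /\ pl A (entry l) != 0.
Proof.
move=> pl0; have [l [s fE]] := injective_schubert (pl_inj pl0).
exists l, s; split=> //; apply: contraNneq pl0 => p0.
by rewrite (eq_pl _ fE) pl_perm p0 mulr0.
Qed.

(** Laplace expansion along the replaced row [q], whose cofactors do not involve that row. *)
Lemma pl_cramer A f :
  A *m \adj (rowsub f A) = \matrix_(p, q) pl A (repl f q p).
Proof.
apply/matrixP => p q; rewrite !mxE /pl (expand_det_row _ q).
apply: eq_bigr => k _; rewrite !mxE /repl eqxx; congr (_ * _).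
rewrite /cofactor; congr (_ * \det _); apply/matrixP => i j; rewrite !mxE.
by rewrite eq_sym (negbTE (neq_lift _ _)).
Qed.

(** When the [f]-minor is nonzero, this is [A] times the inverse of its submatrix on the rows [f].
    In the form of Cramer's rule it visibly depends only on the minors up to a common factor. *)
Definition nrm A f : 'M[F]_(n, d) := \matrix_(p, q) (pl A (repl f q p) / pl A f).

Lemma nrmK A f : pl A f != 0 -> nrm A f *m rowsub f A = A.
Proof.
move=> pl0; rewrite (_ : nrm A f = (pl A f)^-1 *: (A *m \adj (rowsub f A))).
  by rewrite -scalemxAl -mulmxA mul_adj_mx mul_mx_scalar scalerA mulVf// scale1r.
by rewrite pl_cramer; apply/matrixP => p q; rewrite !mxE mulrC.
Qed.

Lemma rowsub_unit A f : pl A f != 0 -> rowsub f A \in unitmx.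
Proof. by rewrite unitmxE unitfE. Qed.

Lemma rowsub_nrm A f : pl A f != 0 -> rowsub f (nrm A f) = 1%:M.
Proof.
move=> pl0; have := congr1 (rowsub f) (nrmK pl0); rewrite -mul_rowsub_mx.
by move/(congr1 (mulmx^~ (invmx (rowsub f A)))); rewrite mulmxK ?mulmxV ?rowsub_unit.
Qed.

(** Injectivity of the Pluecker embedding: [k] cancels in the ratios of minors. Sorting first
    extends the hypothesis from Schubert symbols to all row choices. *)
Lemma eq_pl_colspace A B l (k : F) : pl A (entry l) != 0 -> k != 0 ->
    (forall l', pl B (entry l') = k * pl A (entry l')) ->
  nrm A (entry l) = nrm B (entry l).
Proof.
move=> pl0 k0 AB; have ABf f : pl B f = k * pl A f.
  have [/eqP A0|/pl_sort[l' [s [fE _]]]] := boolP (pl A f == 0).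
    rewrite A0 mulr0; apply/eqP; apply: contraT => /pl_sort[l' [s [fE]]].
    move: A0; rewrite (eq_pl _ fE) pl_perm AB => /eqP.
    by rewrite !mulf_eq0 signr_eq0/= => ->; rewrite orbT.
  by rewrite !(eq_pl _ fE) !pl_perm AB mulrCA.
apply/matrixP => p q; rewrite !mxE !ABf invfM mulrACA divff// mul1r//.
Qed.

Lemma pl_rank A f : pl A f != 0 -> \rank A = d.
Proof.
move=> pl0; apply/eqP; rewrite eqn_leq rank_leq_col/=.
by rewrite -[X in (X <= _)%N](mxrank_unit (rowsub_unit pl0)) mxrankS// rowsub_sub.
Qed.

Lemma rank_pl A : \rank A = d -> exists l, pl A (entry l) != 0.
Proof.
move=> rA; have fA : row_full A by rewrite /row_full rA.
have := fullrowsub_unit fA; rewrite unitmxE unitfE -/(pl A _).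
by move=> /pl_sort[l [s [_ ?]]]; exists l.
Qed.

Lemma cnt_repl_lt f (q : 'I_d) (p : 'I_n) : (f q < p)%N -> ~ cle (repl f q p) f.
Proof.
move=> qp /(_ (f q).+1); apply/negP; rewrite -ltnNge.
apply/proper_card/properP; split.
  apply/fintype.subsetP => i; rewrite !inE /repl; case: eqP => [->|//].
  by rewrite ltnSn.
by exists q; rewrite !inE /repl ?eqxx ?ltnS// -ltnNge.
Qed.

Lemma cle_repl f (q : 'I_d) (p : 'I_n) : (f q <= p)%N -> cle f (repl f q p).
Proof.
by move=> qp; apply: cle_pointwise => i; rewrite /repl; case: eqP => [->|].
Qed.

(* At a locally maximal nonzero minor the normalized matrix is in echelon form. *)
Lemma incell_max A f : pl A f != 0 ->
  (forall g, pl A g != 0 -> cle f g -> cle g f) -> incell A f.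
Proof.
move=> pl0 mx; split=> // g; rewrite -{1}(nrmK pl0) pl_mulr mulf_eq0 negb_or.
move=> /andP[+ _]; rewrite {1}/pl /determinant => Ng0.
(* A nonzero term of the Leibniz expansion uses only nonzero entries of the echelon form, none of
   which lies beyond its pivot; hence [g i <= f (s i)] for all [i]. *)
have [s Ns0] : exists s : {perm 'I_d}, forall i, nrm A f (g i) (s i) != 0.
  apply: contrapT => /forallNP Ns; move: Ng0; rewrite big1 ?eqxx// => s _.
  have /existsNP[i /negP] := Ns s; rewrite negbK => /eqP Ns0.
  by rewrite (bigD1 i)//= mxE Ns0 mul0r mulr0.
have gf i : (g i <= f (s i))%N.
  rewrite leqNgt; apply/negP => lt; apply: (cnt_repl_lt lt).
  apply: mx; last exact/cle_repl/ltnW.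
  by apply: contraNneq (Ns0 i) => p0; rewrite mxE p0 mul0r.
by move=> j; rewrite -(cnt_perm f s); exact: (@cle_pointwise _ _ g (f \o s)).
Qed.

Lemma incell_exists A : \rank A = d -> exists l, incell A (entry l).
Proof.
move=> /rank_pl[l0 pl0]; pose P l := pl A (entry l) != 0.
(* A strictly larger symbol has a strictly larger sum of entries, so maximizing the sum produces a
   maximal symbol. *)
case: (@arg_maxnP _ l0 P (fun l => \sum_q entry l q)%N pl0) => l Pl lmax.
exists l; apply: incell_max => // g /pl_sort[l' [s [gE Pl']]].
have cg j : cnt g j = cnt (entry l') j by rewrite (cnt_eq _ gE) cnt_perm.
move=> lg; have /cle_entryP ll' : cle (entry l) (entry l').
  by move=> j; rewrite -cg.
suff l'l : schubert_le l' l by move=> j; rewrite cg; move: j; apply/cle_entryP.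
move=> q; rewrite leqNgt; apply/negP => lt.
have := lmax _ Pl'; rewrite /= leqNgt => /negP; apply.
rewrite (bigD1 q)//= [X in (_ < X)%N](bigD1 q)//= -addSn leq_add//.
exact: leq_sum.
Qed.

Lemma incell_le A l l' : incell A (entry l) -> pl A (entry l') != 0 ->
  schubert_le l' l.
Proof. by move=> [_ Al] /Al /cle_entryP. Qed.

Definition flagdim A (j : nat) : nat := \rank (A^T :&: (pid_mx j : 'M[F]_n))%MS.

Lemma sub_pid_mxP m (W : 'M[F]_(m, n)) j :
  (W <= (pid_mx j : 'M[F]_n))%MS <-> forall i (p : 'I_n), (j <= p)%N -> W i p = 0.
Proof.
split=> [/submxP[D ->] i p jp|W0].
  by rewrite !mxE big1// => k _; rewrite mxE; case: eqP => [->|]; rewrite ?ltnNge ?jp ?mulr0.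
suff -> : W = W *m pid_mx j by exact: submxMl.
apply/matrixP => i p; rewrite mxE (bigD1 p)//= big1 => [|k kp].
  rewrite mxE eqxx addr0/=; case: ltnP => [|/W0->]; by rewrite ?mulr1 ?mul0r.
by rewrite mxE (_ : (k == p :> nat) = false) ?mulr0//; apply/negbTE.
Qed.

(** A vector of the column space is determined by its coordinates in the rows [g], and inside [C^j]
    those with [g q >= j] vanish. *)
Lemma flagdim_le A g j : pl A g != 0 -> (flagdim A j <= cnt g j)%N.
Proof.
move=> pl0; rewrite /flagdim; set W := (_ :&: _)%MS.
have /submxP[D WD] : (W <= A^T)%MS by exact: capmxSl.
have W0 : forall i (p : 'I_n), (j <= p)%N -> W i p = 0.
  by apply/sub_pid_mxP; exact: capmxSr.
have DE : D = colsub g W *m invmx (rowsub g A)^T.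
  rewrite WD -mulmx_colsub -trmx_mxsub mulmxK// unitmx_tr.
  exact: rowsub_unit.
have rWD : (\rank W <= \rank (colsub g W))%N.
  rewrite [in X in (X <= _)%N]WD DE.
  exact: leq_trans (mxrankM_maxl _ _) (mxrankM_maxl _ _).
apply: leq_trans rWD _; set P := [pred q | (g q < j)%N].
pose e (i : 'I_#|P|) : 'I_d := enum_val i.
rewrite (_ : colsub g W = colsub e (colsub g W) *m rowsub e 1%:M).
  exact: leq_trans (mxrankM_maxl _ _) (rank_leq_col _).
apply/matrixP => i q; rewrite !mxE.
have [Pq|Pq] := boolP (q \in P); last first.
  rewrite W0; last by rewrite leqNgt.
  rewrite big1// => k _; rewrite !mxE; case: eqP => [kq|]; rewrite ?mulr0//.
  by have := enum_valP k; rewrite -/(e k) kq (negbTE Pq).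
rewrite (bigD1 (enum_rank_in Pq q))//= big1 => [|k kq].
  by rewrite !mxE /e enum_rankK_in// eqxx mulr1 addr0.
rewrite !mxE; case: eqP => [ekq|]; rewrite ?mulr0//.
by case/eqP: kq; apply: enum_val_inj; rewrite enum_rankK_in.
Qed.

(** The columns of the echelon form with pivot [f q < j] are independent and lie in [C^j], which
    attains the upper bound. *)
Lemma flagdim_incell A f j : incell A f -> flagdim A j = cnt f j.
Proof.
move=> [pl0 Af]; apply/eqP; rewrite eqn_leq flagdim_le//=.
set P := [pred q | (f q < j)%N]; pose e (i : 'I_#|P|) : 'I_d := enum_val i.
pose K := rowsub e (nrm A f)^T.
have KA : (K <= A^T)%MS.
  apply: submx_trans (rowsub_sub _ _) _.
  have -> : nrm A f = A *m invmx (rowsub f A).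
    by rewrite -[X in X *m _](nrmK pl0) mulmxK// rowsub_unit.
  by rewrite trmx_mul submxMl.
have Kj : (K <= (pid_mx j : 'M[F]_n))%MS.
  apply/sub_pid_mxP => i p jp; rewrite !mxE.
  suff /eqP -> : pl A (repl f (e i) p) == 0 by rewrite mul0r.
  apply: contraT => /Af; have := enum_valP i; rewrite inE => fj.
  by move=> /cnt_repl_lt; case; exact: leq_trans jp.
have KAj : (K <= A^T :&: (pid_mx j : 'M[F]_n))%MS by rewrite sub_capmx KA Kj.
apply: leq_trans (mxrankS KAj).
have : row_free K.
  apply/row_freeP; exists (colsub (f \o e) 1%:M).
  apply/matrixP => i k; rewrite !mxE (bigD1 (f (e k)))//= big1 => [|p pk].
    have /matrixP/(_ (e k) (e i)) := rowsub_nrm pl0.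
    rewrite !mxE eqxx mulr1 addr0 => ->.
    by rewrite (inj_eq enum_val_inj) eq_sym.
  by rewrite !mxE (negbTE pk) mulr0.
by rewrite /row_free => /eqP ->.
Qed.

(** Some symbol always fits, and its flag dimensions are its counts; the prescribed jumps then force
    it to be [l]. *)
Lemma incell_flagP A l : \rank A = d -> incell A (entry l) <->
  forall q : 'I_d, flagdim A (entry l q).+1 = q.+1 /\ flagdim A (entry l q) = q.
Proof.
move=> rA; split=> [Al q|flag].
  by rewrite !(flagdim_incell _ Al) cnt_entry cnt_entryS.
have [l' Al'] := incell_exists rA; suff -> : l = l' by [].
apply: schubert_le_anti => q; have [] := flag q; rewrite !(flagdim_incell _ Al') => c1 c0.
  rewrite leqNgt; apply/negP => /(leq_cnt (entry l')).
  by rewrite c0 cnt_entryS ltnn.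
rewrite leqNgt; apply/negP => /(leq_cnt (entry l')).
by rewrite c1 cnt_entry ltnn.
Qed.

End Minors.

(** * Matrices acting on two consecutive rows *)

Section Block.
Variables (F : fieldType) (n d : nat) (a b : 'I_n) (ab : b = a.+1 :> nat).
Implicit Types (A : 'M[F]_(n, d)) (f g h : 'I_d -> 'I_n).

Definition blk (x y z t : F) : 'M[F]_n := \matrix_(i, j)
  if i == a then x *+ (j == a) + y *+ (j == b)
  else if i == b then z *+ (j == a) + t *+ (j == b) else (i == j)%:R.

Let nab : (b == a) = false.
Proof. by apply/eqP => /(congr1 val)/= /esym; rewrite ab => /n_Sn. Qed.

Lemma sum_pick (G : 'I_n -> F) i : \sum_j (i == j)%:R * G j = G i.
Proof.
rewrite (bigD1 i)//= big1 ?eqxx ?mul1r ?addr0// => j ji.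
by rewrite eq_sym (negbTE ji) mul0r.
Qed.

Lemma sum_pick2 (G : 'I_n -> F) x y :
  \sum_j (x *+ (j == a) + y *+ (j == b)) * G j = x * G a + y * G b.
Proof.
rewrite -(sum_pick G a) -(sum_pick G b) !mulr_sumr -big_split/=.
apply: eq_bigr => j _; rewrite mulrDl ![_ == j]eq_sym.
by case: (j == a); case: (j == b); rewrite ?mulr0n ?mulr1n ?mul1r ?mul0r ?mulr0.
Qed.

Lemma mul_blkE m (A : 'M[F]_(n, m)) x y z t i k : (blk x y z t *m A) i k =
  if i == a then x * A a k + y * A b k
  else if i == b then z * A a k + t * A b k else A i k.
Proof.
rewrite mxE; under eq_bigr do rewrite mxE.
by case: eqP => // _; [exact: sum_pick2|case: eqP => // _;
  [exact: sum_pick2|exact: sum_pick (A^~ k) i]].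
Qed.

Lemma blkM x y z t x' y' z' t' : blk x y z t *m blk x' y' z' t' =
  blk (x * x' + y * z') (x * y' + y * t') (z * x' + t * z') (z * y' + t * t').
Proof.
apply/matrixP => i k; rewrite mul_blkE !mxE eqxx nab eqxx.
by do 2?case: eqP => // _; case: (k == a); case: (k == b);
  rewrite ?mulr0n ?mulr1n ?addr0 ?add0r ?mulr0 ?addr0 ?add0r ?mulrDr// addrACA.
Qed.

Lemma blk1 : blk 1 0 0 1 = 1%:M.
Proof.
apply/matrixP => i k; rewrite !mxE [i == k]eq_sym.
case: (i =P a) => [->|_]; first by rewrite mul0rn addr0.
by case: (i =P b) => [->|_//]; rewrite mul0rn add0r.
Qed.

(** Multilinearity in row [q], the only selected row that the block changes. *)
Lemma pl_blk x y z t A f q : f q = b -> (forall i, f i != a) -> injective f ->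
  pl (blk x y z t *m A) f = z * pl A (repl f q a) + t * pl A f.
Proof.
move=> fq fa fi; apply: (@determinant_multilinear _ _ _ _ _ q).
- apply/rowP => k; rewrite mxE [in LHS]mxE mul_blkE fq nab eqxx !mxE.
  by rewrite /repl eqxx fq.
- apply/matrixP => i k; rewrite ![LHS]mxE [RHS]mxE [RHS]mxE mul_blkE.
  rewrite /repl eq_sym (negbTE (neq_lift _ _)) (negbTE (fa _)) -fq (inj_eq fi).
  by rewrite eq_sym (negbTE (neq_lift _ _)).
- apply/matrixP => i k; rewrite ![LHS]mxE [RHS]mxE [RHS]mxE mul_blkE.
  rewrite (negbTE (fa _)) -fq (inj_eq fi).
  by rewrite eq_sym (negbTE (neq_lift _ _)).
Qed.

Lemma pl_blk' x y z t A f q : f q = a -> (forall i, f i != b) -> injective f ->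
  pl (blk x y z t *m A) f = x * pl A f + y * pl A (repl f q b).
Proof.
move=> fq fb fi; apply: (@determinant_multilinear _ _ _ _ _ q).
- apply/rowP => k; rewrite mxE [in LHS]mxE mul_blkE fq eqxx !mxE.
  by rewrite /repl eqxx fq.
- apply/matrixP => i k; rewrite ![LHS]mxE [RHS]mxE [RHS]mxE mul_blkE.
  rewrite (negbTE (fb _)) -fq (inj_eq fi).
  by rewrite eq_sym (negbTE (neq_lift _ _)).
- apply/matrixP => i k; rewrite ![LHS]mxE [RHS]mxE [RHS]mxE mul_blkE.
  rewrite /repl eq_sym (negbTE (neq_lift _ _)) (negbTE (fb _)) -fq (inj_eq fi).
  by rewrite eq_sym (negbTE (neq_lift _ _)).
Qed.

(** In a nonzero term of the expansion every row comes from itself, except that [a] and [b] may come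
    from each other. Only the count of values below [b] separates these two rows. *)
Lemma pl_blk_supp x y z t A g : pl (blk x y z t *m A) g != 0 ->
  exists h, pl A h != 0 /\ forall j, j != b :> nat -> cnt h j = cnt g j.
Proof.
rewrite pl_mull => s0.
have [h] : exists h : {ffun 'I_d -> 'I_n},
    (\prod_i blk x y z t (g i) (h i)) * pl A h != 0.
  apply: contrapT => /forallNP h0; case/eqP: s0; rewrite big1// => h _.
  by have /negP := h0 h; rewrite negbK => /eqP.
rewrite mulf_eq0 negb_or => /andP[/prodf_neq0 U0 p0]; exists h; split=> // j jb.
apply: eq_card => i; rewrite !inE.
have /(_ isT) := U0 i; rewrite !mxE; move/eqP: jb; rewrite ab => jb.
have in2 (x' y' : F) : x' *+ (h i == a) + y' *+ (h i == b) != 0 ->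
    (h i < j)%N = (a < j)%N.
  case: (h i =P a) => [->//|_]; case: (h i =P b) => [->|_].
    by move=> _; rewrite ab; apply/idP/idP; lia.
  by rewrite !mulrb addr0 eqxx.
case: (g i =P a) => [->|_]; first exact: in2.
case: (g i =P b) => [->|_].
  by move=> /in2 ->; rewrite ab; apply/idP/idP; lia.
by case: (g i =P h i) => [->//|_]; rewrite eqxx.
Qed.

(** As [f] misses [a], its counts at [a] and [b] agree, so the count that may change is controlled
    by the one at [a]. Together with [pl_blk_supp], a block on rows [a] and [b] preserves the
    Schubert variety of [f]. *)
Lemma cle_blk f g h : (forall i, f i != a) -> cle h f ->
  (forall j, j != b :> nat -> cnt h j = cnt g j) -> cle g f.
Proof.
move=> fa hf hg j; have [->|jb] := eqVneq j (b : nat); last first.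
  by rewrite -hg//; exact: hf.
have -> : cnt f b = cnt f a.
  apply: eq_card => i; rewrite !inE ab ltnS leq_eqVlt.
  by rewrite (inj_eq val_inj) (negbTE (fa i)).
apply: leq_trans (hf a) _; rewrite hg; first by rewrite leq_cnt// ab.
by rewrite ab; apply/eqP => /n_Sn.
Qed.

End Block.

(** * Continuity of field-valued functions and of minors *)

Section ContinuousField.
Variables (K : numFieldType) (T : topologicalType).
Implicit Types f g : T -> K.

Lemma contD f g : continuous f -> continuous g -> continuous (fun x => f x + g x).
Proof. by move=> cf cg x; apply: cvgD; [exact: cf|exact: cg]. Qed.

Lemma contN f : continuous f -> continuous (fun x => - f x).
Proof. by move=> cf x; apply: cvgN; exact: cf. Qed.

Lemma contM f g : continuous f -> continuous g -> continuous (fun x => f x * g x).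
Proof. by move=> cf cg x; apply: cvgM; [exact: cf|exact: cg]. Qed.

Lemma contV f : (forall x, f x != 0) -> continuous f -> continuous (fun x => (f x)^-1).
Proof. by move=> f0 cf x; apply: cvgV; [exact: f0|exact: cf]. Qed.

Lemma cont_cst (c : K) : continuous (fun _ : T => c).
Proof. by move=> x; exact: cvg_cst. Qed.

Lemma cont_norm f : continuous f -> continuous (fun x => `|f x|).
Proof. by move=> cf x; apply: cvg_norm; exact: cf. Qed.

Lemma cont_sum (I : Type) (r : seq I) (P : pred I) (F : I -> T -> K) :
  (forall i, continuous (F i)) -> continuous (fun x => \sum_(i <- r | P i) F i x).
Proof.
move=> cF; elim: r => [|i r IHr].
  by under eq_fun do rewrite big_nil; exact: cont_cst.
under eq_fun do rewrite big_cons; case: (P i) => //.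
exact: contD.
Qed.

Lemma cont_prod (I : Type) (r : seq I) (P : pred I) (F : I -> T -> K) :
  (forall i, continuous (F i)) -> continuous (fun x => \prod_(i <- r | P i) F i x).
Proof.
move=> cF; elim: r => [|i r IHr].
  by under eq_fun do rewrite big_nil; exact: cont_cst.
under eq_fun do rewrite big_cons; case: (P i) => //.
exact: contM.
Qed.

Lemma cont_pl n d (A : T -> 'M[K]_(n, d)) (f : 'I_d -> 'I_n) :
  (forall i j, continuous (fun x => A x i j)) -> continuous (fun x => pl (A x) f).
Proof.
move=> cA; apply: cont_sum => s; apply: contM; first exact: cont_cst.
by apply: cont_prod => i; under eq_fun do rewrite mxE; exact: cA.
Qed.

End ContinuousField.

Lemma cont_conj (K : numClosedFieldType) (T : topologicalType) (f : T -> K) :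
  continuous f -> continuous (fun x => (f x)^*).
Proof.
move=> cf x; apply: (continuous_comp (cf x)) => /=.
have FF := nbhs_filter (f x); apply/cvgrPdist_lt => e e0; exists e => //= y /=.
by rewrite -rmorphB norm_conjC.
Qed.

(** * Bott-Samelson charts *)

Section BottSamelson.
Variables (R : realType) (n d : nat).
Local Notation C := (Cplx R).
Implicit Types (f g h : 'I_d -> 'I_n).

(* A multiple of an element of SU(2) acting on rows a and b = a + 1; the entry
   1 - |v| vanishes exactly on the boundary of the unit disk. *)
Definition bs_block (a b : 'I_n) (v : C) : 'M[C]_n :=
  blk a b v (- (1 - `|v|)) (1 - `|v|) v^*.

(** The inverse block for [|v| <= 1]: the adjugate divided by the determinant [D]. *)
Definition bs_unblock (a b : 'I_n) (v : C) : 'M[C]_n :=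
  let D := `|v| ^+ 2 + (1 - `|v|) ^+ 2 in
  blk a b (v^* / D) ((1 - `|v|) / D) (- (1 - `|v|) / D) (v / D).

Lemma bs_den_neq0 (v : C) : `|v| <= 1 -> `|v| ^+ 2 + (1 - `|v|) ^+ 2 != 0.
Proof.
move=> v1; rewrite paddr_eq0 ?exprn_ge0 ?subr_ge0//.
by rewrite !expf_eq0/= normr_eq0; case: eqP => // ->; rewrite normr0 subr0 oner_eq0.
Qed.

Lemma bs_blockK (a b : 'I_n) (v : C) : b = a.+1 :> nat -> `|v| <= 1 ->
  bs_unblock a b v *m bs_block a b v = 1%:M /\
  bs_block a b v *m bs_unblock a b v = 1%:M.
Proof.
move=> ab /bs_den_neq0 D0; have vv : `|v| ^+ 2 = v * v^* by rewrite normCK.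
rewrite /bs_unblock /bs_block vv !blkM// -[in X in _ = X](@blk1 _ _ a b)//.
rewrite -[in X in _ /\ _ = X](@blk1 _ _ a b)//.
move: D0; rewrite vv; set s := 1 - `|v|; set w := v^* => D0.
by split; congr blk; field.
Qed.

(** The real off-diagonal entries force [u a] and [u b] to trade places on the right; the diagonal
    entries then pick up the phase [u a / u b] and its conjugate. *)
Lemma bs_block_diag (a b : 'I_n) (u : 'I_n -> C) (v : C) : b = a.+1 :> nat ->
  (forall p, `|u p| = 1) ->
  diag_mx (\row_p u p) *m bs_block a b v =
  bs_block a b (u a / u b * v) *m diag_mx (\row_p u (tperm a b p)).
Proof.
move=> ab u1; have u0 p : u p != 0 by rewrite -normr_eq0 u1 oner_eq0.
have nab : (b == a) = false.
  by apply/eqP => /(congr1 val)/= /esym; rewrite ab => /n_Sn.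
have uc p : (u p)^* = (u p)^-1.
  by apply/(mulfI (u0 p)); rewrite -normCK u1 expr1n divff.
have nu : `|u a / u b * v| = `|v| by rewrite !normrM normfV !u1 invr1 !mul1r.
have conjE : (u a / u b * v)^* = u b / u a * v^*.
  rewrite rmorphM rmorphM/= fmorphV uc -[X in _ / X * _]/((u b)^*) uc invrK.
  by rewrite [_^-1 * _]mulrC.
rewrite /bs_block nu mul_diag_mx mul_mx_diag; apply/matrixP => i k; rewrite !mxE.
rewrite conjE.
have [->|ia] := eqVneq i a; [|have [->|ib] := eqVneq i b].
- have [->|ka] := eqVneq k a; first by rewrite tpermL eq_sym nab/=; field.
  have [->|kb] := eqVneq k b; first by rewrite tpermR/=; ring.
  by rewrite !mulr0n; ring.
- have [->|ka] := eqVneq k a; first by rewrite tpermL eq_sym nab/=; ring.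
  have [->|kb] := eqVneq k b; first by rewrite tpermR/=; field.
  by rewrite !mulr0n; ring.
have [<-|ik] := eqVneq i k; last by rewrite mulr0 mul0r.
by rewrite mulr1 mul1r tpermD// eq_sym.
Qed.

Lemma closed_image f : (forall q (p : 'I_n), f q = p.+1 :> nat -> exists r, f r = p) ->
  forall (p : 'I_n), (forall q, f q != p) -> forall q, (f q < p)%N.
Proof.
move=> cf p np q; rewrite ltnNge; apply/negP => pq.
suff [r rp] : exists r, f r = p by have := np r; rewrite rp eqxx.
have [k] := ubnP (f q - p); elim: k q pq => // k IHk q.
rewrite leq_eqVlt => /orP[/eqP/val_inj pq _|pq]; first by exists q.
have q0 : ((f q).-1 < n)%N by apply: leq_ltn_trans (leq_pred _) (ltn_ord _).
have [|r rq] := cf q (Ordinal q0); first by rewrite /= prednK// (leq_ltn_trans _ pq).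
by rewrite ltnS => h; apply: (IHk r); rewrite rq/=; lia.
Qed.

(* A Bott-Samelson chart: an open polydisk parametrizes the cell of f, and the
   boundary of the polydisk is sent to smaller cells.  Continuity is stated
   through maps from an arbitrary space, so that no topology on the space of
   parameters is needed. *)
Record bott_samelson f (l : nat) (Phi : ('I_l -> C) -> 'M[C]_(n, d)) : Prop := {
  bs_continuous : forall (T : topologicalType) (g : T -> 'I_l -> C),
    (forall k, continuous (g^~ k)) -> forall i j, continuous (fun x => Phi (g x) i j);
  bs_supp : forall v, (forall k, `|v k| <= 1) -> forall g, pl (Phi v) g != 0 -> cle g f;
  bs_rank : forall v, (forall k, `|v k| <= 1) -> \rank (Phi v) = d;
  bs_minor : forall v, (forall k, `|v k| <= 1) -> pl (Phi v) f = \prod_k (1 - `|v k|);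
  bs_surj : forall A, incell A f -> exists v T,
    [/\ forall k, `|v k| < 1, T \in unitmx & A = Phi v *m T];
  bs_inj : forall v v' T, (forall k, `|v k| < 1) -> (forall k, `|v' k| < 1) ->
    T \in unitmx -> Phi v = Phi v' *m T -> v =1 v';
  bs_equiv : forall u : 'I_n -> C, (forall p, `|u p| = 1) -> exists chi : 'I_l -> C,
    (forall k, `|chi k| = 1) /\ forall v, (forall k, `|v k| <= 1) ->
    exists2 T, \det T = \prod_q u (f q) &
      diag_mx (\row_p u p) *m Phi v = Phi (fun k => chi k * v k) *m T }.

Lemma bs_interior f l (Phi : ('I_l -> C) -> 'M[C]_(n, d)) v :
  bott_samelson f Phi -> (forall k, `|v k| <= 1) ->
  pl (Phi v) f != 0 <-> forall k, `|v k| < 1.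
Proof.
move=> BS v1; rewrite (bs_minor BS v1); split=> [/prodf_neq0 p0 k|p0].
  by have /(_ isT) := p0 k; rewrite subr_eq0 lt_def v1 andbT.
by apply/prodf_neq0 => k _; rewrite subr_eq0 gt_eqF.
Qed.

Lemma bott_samelson_base f : injective f ->
  (forall q (p : 'I_n), f q = p.+1 :> nat -> exists r, f r = p) ->
  bott_samelson f (fun _ : 'I_0 -> C => \matrix_(p, q) (p == f q)%:R).
Proof.
move=> fi cf; set A0 : 'M[C]_(n, d) := \matrix_(p, q) _.
have A0f : rowsub f A0 = 1%:M.
  by apply/matrixP => i j; rewrite !mxE (inj_eq fi).
have pl1 : pl A0 f != 0 by rewrite /pl A0f det1 oner_neq0.
split.
- by move=> T g _ i j; exact: cont_cst.
- move=> v _; apply: (incell_max pl1 _).2 => g pg _.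
  have [s sg] : exists s : {perm 'I_d}, g =1 f \o s.
    have fg i : exists r, f r == g i.
      apply: contrapT => /forallNP nf; case/eqP: pg; rewrite /pl.
      rewrite (expand_det_row _ i) big1// => j _; rewrite !mxE.
      by case: eqP => [gi|]; rewrite ?mul0r//; have := nf j; rewrite -gi eqxx.
    have xi : injective (fun i => xchoose (fg i)).
      move=> i j /(congr1 f); rewrite (eqP (xchooseP (fg i))) (eqP (xchooseP (fg j))).
      exact: (pl_inj pg).
    by exists (perm xi) => i; rewrite /= permE (eqP (xchooseP (fg i))).
  by move=> j; rewrite (cnt_eq _ sg) cnt_perm.
- by move=> v _; exact: pl_rank pl1.
- by move=> v _; rewrite big_ord0 /pl A0f det1.
- move=> A [Af0 Af]; exists (fun=> 0), (rowsub f A); split; [by case| |].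
    exact: rowsub_unit.
  (* Rows in the image of [f] form an identity matrix; every other row lies beyond all pivots and
     vanishes in the echelon form. *)
  rewrite -[LHS](nrmK Af0); congr (_ *m _); apply/matrixP => p q.
  have [[r <-]|np] := pselect (exists r, f r = p).
    have /matrixP/(_ r q) := rowsub_nrm Af0.
    by rewrite !mxE (inj_eq fi).
  rewrite !mxE; case: eqP => [pq|_]; first by case: np; exists q.
  have nfp i : f i != p by apply/eqP => fip; apply: np; exists i.
  have /cnt_repl_lt ncle := closed_image cf nfp q.
  suff /eqP -> : pl A (repl f q p) == 0 by rewrite mul0r.
  by apply: contraT => /Af.
- by move=> v v' T _ _ _ _ [].
- move=> u u1; exists (fun=> 1); split=> [[]//|v _].
  exists (diag_mx (\row_q u (f q))).
    by rewrite det_diag; apply: eq_bigr => q _; rewrite mxE.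
  rewrite mul_diag_mx mul_mx_diag; apply/matrixP => p q; rewrite !mxE.
  by case: eqP => [->|]; rewrite ?mulr1 ?mul1r ?mulr0 ?mul0r.
Qed.

(** Lowering an entry of [f] to the free row [a] gives a cell with one complex parameter fewer; a
    block on rows [a] and [a + 1] restores that parameter. *)
Lemma bott_samelson_step f q (a : 'I_n) l (Phi : ('I_l -> C) -> 'M[C]_(n, d)) :
  injective f -> f q = a.+1 :> nat -> (forall i, f i != a) ->
  bott_samelson (repl f q a) Phi ->
  bott_samelson f (fun v : 'I_l.+1 -> C =>
    bs_block a (f q) (v ord0) *m Phi (fun k => v (lift ord0 k))).
Proof.
move=> fi; set b := f q => ab fa; set f' := repl f q a => BS.
have f'f : cle f' f.
  by apply: cle_pointwise => i; rewrite /f' /repl; case: eqP => [->|//]; rewrite -/b ab.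
have nff' : ~ cle f f'.
  have f'E : repl f' q b =1 f.
    by move=> i; rewrite /f' /repl; case: eqP => [->|].
  move=> ff'; apply: (@cnt_repl_lt _ _ f' q b); first by rewrite /f' /repl eqxx ab.
  by move=> j; rewrite (cnt_eq _ f'E).
have f'q : f' q = a by rewrite /f' /repl eqxx.
have f'b i : f' i != b.
  rewrite /f' /repl; case: (i =P q) => [_|iq]; last first.
    by apply/eqP => /fi.
  by apply/eqP => /(congr1 val)/=; rewrite ab => /n_Sn.
have f'i : injective f'.
  move=> i j; rewrite /f' /repl; case: eqP => [->|_]; case: eqP => [->|_] //.
  - by move=> /esym /eqP; rewrite (negbTE (fa _)).
  - by move=> /eqP; rewrite (negbTE (fa _)).
  - exact: fi.
have f'K (A : 'M[C]_(n, d)) : pl A (repl f' q b) = pl A f.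
  by apply: eq_pl => i; rewrite /f' /repl; case: eqP => [->|].
(* The [f]-minor of [Phi v] vanishes, as [f] is not below [f']. Both minors of the product thus come
   from the [f']-minor, and the ratio of the [f']-minor to the [f]-minor, when [|w| < 1], is
   [w / (1 - |w|)]. *)
have plf v (X : 'M[C]_(n, d)) : (forall k, `|v k| <= 1) -> X = Phi v ->
    forall w, pl (bs_block a b w *m X) f = (1 - `|w|) * pl X f' /\
              pl (bs_block a b w *m X) f' = w * pl X f'.
  move=> v1 -> w; have pf0 : pl (Phi v) f = 0.
    by apply/eqP; apply: contraT => /(bs_supp BS v1)/nff'.
  rewrite /bs_block (@pl_blk _ _ _ _ _ ab _ _ _ _ _ _ q)//.
  by rewrite (@pl_blk' _ _ _ _ _ _ _ _ _ _ _ q)// f'K pf0 !mulr0 !addr0.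
split.
- move=> T g cg i j; under eq_fun do rewrite mul_blkE//.
  have cv : continuous (fun x => g x ord0) := cg ord0.
  have cP p : continuous (fun x => Phi (fun k => g x (lift ord0 k)) p j).
    exact: (bs_continuous BS (fun k => cg (lift ord0 k))).
  have cs : continuous (fun x => 1 - `|g x ord0|).
    exact: contD (@cont_cst _ _ _) (contN (cont_norm cv)).
  case: (i == a); last case: (i == b); last exact: cP.
    exact: contD (contM cv (cP a)) (contM (contN cs) (cP b)).
  exact: contD (contM cs (cP a)) (contM (cont_conj cv) (cP b)).
- move=> v vk g; have v0 := vk ord0; have v1 k := vk (lift ord0 k).
  move=> /(pl_blk_supp ab)[h [hP hg]].
  by apply: (cle_blk ab fa _ hg); exact: cle_trans (bs_supp BS v1 hP) f'f.
- move=> v vk; have v0 := vk ord0; have v1 k := vk (lift ord0 k); have [K1 _] := bs_blockK ab v0.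
  have U : bs_block a b (v ord0) \in unitmx by case/mulmx1_unit: K1.
  by rewrite eqmxMfull ?row_full_unit// (bs_rank BS).
- move=> v vk; have v0 := vk ord0; have v1 k := vk (lift ord0 k); have [-> _] := plf _ _ v1 erefl (v ord0).
  by rewrite big_ord_recl (bs_minor BS v1).
- move=> A [Af0 Af].
  (* The solution of [w / (1 - |w|) = r]; with it, removing the block kills the [f]-minor. *)
  pose r := pl A f' / pl A f; pose w := r / (1 + `|r|).
  have r1 : 0 < 1 + `|r| by rewrite ltr_pwDl.
  have nw : `|w| = `|r| / (1 + `|r|) by rewrite normrM normfV (gtr0_norm r1).
  have sw : 1 - `|w| = (1 + `|r|)^-1.
    by rewrite nw; field; rewrite gt_eqF.
  have w1 : `|w| < 1 by rewrite -subr_gt0 sw invr_gt0.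
  have wr : w = r * (1 - `|w|) by rewrite sw.
  have [K1 K2] := bs_blockK ab (ltW w1).
  pose X := bs_unblock a b w *m A.
  have D0 := bs_den_neq0 (ltW w1).
  have Xf : pl X f = 0.
    rewrite /X /bs_unblock (@pl_blk _ _ _ _ _ ab _ _ _ _ _ _ q)// -/f'.
    rewrite [X in _ + X / _ * _]wr /r -mulrA mulrC; field.
    by rewrite D0.
  have Xf' : pl X f' != 0.
    rewrite /X /bs_unblock (@pl_blk' _ _ _ _ _ _ _ _ _ _ _ q)// f'K.
    have -> : pl A f' = r * pl A f by rewrite /r mulfVK.
    set D := `|w| ^+ 2 + _; have sc : (1 - `|w|)^* = 1 - `|w|.
      by rewrite rmorphB rmorph1/= conj_normC.
    have -> : w^* / D * (r * pl A f) + (1 - `|w|) / D * pl A f =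
        (1 - `|w|) / D * pl A f * (1 + `|r| ^+ 2).
      by rewrite {1}wr rmorphM/= sc normCK; ring.
    have r2 : 1 + `|r| ^+ 2 != 0 by rewrite gt_eqF// ltr_pwDl// exprn_ge0.
    by rewrite !mulf_neq0// ?invr_eq0// sw invr_eq0 gt_eqF.
  (* The counts of [f'] and [f] differ only at [b], by at most one. A row choice between [f'] and
     [f] is therefore below [f'] or a permutation of [f], and [Xf] rules out the latter. *)
  have XA : incell X f'.
    apply: incell_max; first exact: Xf'.
    move=> g Xg f'g; have /(pl_blk_supp ab)[h [hP hg]] := Xg.
    have gf : cle g f by apply: (cle_blk ab fa _ hg); exact: Af.
    have f'f_eq j : j != b :> nat -> cnt f' j = cnt f j.
      move=> jb; apply: eq_card => i; rewrite !inE /f' /repl; case: eqP => [->|//].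
      by move/eqP: jb; rewrite -/b ab => jb; apply/idP/idP; lia.
    move=> j; have [->|jb] := eqVneq j (b : nat); last by rewrite f'f_eq.
    rewrite leqNgt; apply/negP => gb.
    have f'b1 : (cnt f' b <= (cnt f b).+1)%N.
      pose P := [predU1 q & [pred i | (f i < b)%N]].
      apply: (@leq_trans #|P|); last by rewrite cardU1 inE -/b ltnn.
      apply/subset_leq_card/fintype.subsetP => i; rewrite !inE /f' /repl.
      by case: eqP.
    have fg : cle f g.
      move=> k; have [->|kb] := eqVneq k (b : nat); last by rewrite -f'f_eq.
      by rewrite -ltnS; exact: leq_trans gb f'b1.
    have [s gE] := cle_anti_perm fi (pl_inj Xg) fg gf.
    by case/eqP: Xg; rewrite (eq_pl _ gE) pl_perm Xf mulr0.
  have [v [T [v1 uT XE]]] := bs_surj BS XA.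
  exists (fun k => if unlift ord0 k is Some j then v j else w), T; split=> //.
    by move=> k; case: unliftP.
  rewrite unlift_none -mulmxA (_ : Phi _ = Phi v); last first.
    by congr Phi; apply/funext => k; rewrite liftK.
  by rewrite -XE /X mulmxA K2 mul1mx.
- move=> v v' T vk vk' uT E; have v0 := vk ord0; have v1 k := vk (lift ord0 k).
  have v0' := vk' ord0; have v1' k := vk' (lift ord0 k).
  have W1 : forall k, `|v (lift ord0 k)| <= 1 by move=> k; exact: ltW.
  have W1' : forall k, `|v' (lift ord0 k)| <= 1 by move=> k; exact: ltW.
  have [P1 P2] := plf _ _ W1 erefl (v ord0).
  have [P1' P2'] := plf _ _ W1' erefl (v' ord0).
  have X0 := (bs_interior BS W1).2 v1; have X0' := (bs_interior BS W1').2 v1'.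
  have E1 := congr1 (fun M : 'M[C]_(n, d) => pl M f) E.
  have E2 := congr1 (fun M : 'M[C]_(n, d) => pl M f') E.
  rewrite /= !pl_mulr -/b P1 P1' in E1; rewrite /= !pl_mulr -/b P2 P2' in E2.
  have dT : \det T != 0 by rewrite -unitfE -unitmxE.
  move: E1 E2 X0 X0' dT; set x := pl _ f'; set x' := pl _ f'; set t := \det T.
  set z := v ord0; set z' := v' ord0 => E1 E2 X0 X0' dT.
  (* Cross-multiplying the two minor identities eliminates [x], [x'] and [t]. Taking moduli then
     gives [|z| = |z'|], and the factor [1 - |z'|] cancels. *)
  have zz : z * (1 - `|z'|) = z' * (1 - `|z|).
    have y0 : x * x' * t != 0 by exact: mulf_neq0 (mulf_neq0 X0 X0') dT.
    apply: (mulIf y0).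
    have -> : z * (1 - `|z'|) * (x * x' * t) = (z * x) * ((1 - `|z'|) * x' * t) by ring.
    by rewrite E2 -E1; ring.
  have nz : `|z| = `|z'|.
    have : `|z| * (1 - `|z'|) = `|z'| * (1 - `|z|).
      have := congr1 Num.norm zz; rewrite !normrM.
      by rewrite ![`|1 - _|]ger0_norm// subr_ge0 ltW.
    by rewrite !mulrBr !mulr1 [`|z'| * _]mulrC => /addIr.
  have zE : z = z'.
    by move: zz; rewrite nz; apply: mulIf; rewrite subr_eq0 gt_eqF.
  have [K1 _] := bs_blockK ab (ltW v0).
  have := congr1 (mulmx (bs_unblock a b z)) E.
  rewrite -/z -/z' -zE -!mulmxA !mulmxA K1 !mul1mx => E'.
  have vv' := bs_inj BS v1 v1' uT E'.
  by move=> k; case: (unliftP ord0 k) => [j ->|->]; [exact: vv'|exact: zE].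
(* The remaining blocks see the phases with [u a] and [u b] exchanged, because [diag_mx] has been
   moved past the first block. *)
- move=> u u1; have [chi [chi1 Hchi]] := bs_equiv BS (fun p => u1 (tperm a b p)).
  exists (fun k => if unlift ord0 k is Some j then chi j else u a / u b); split.
    by move=> k; case: unliftP => //; rewrite normrM normfV !u1 invr1 mulr1.
  move=> v vk; have v0 := vk ord0; have v1 k := vk (lift ord0 k); have [T dT E] := Hchi _ v1; exists T.
    rewrite dT; apply: eq_bigr => i _; rewrite /f' /repl.
    case: eqP => [->|/eqP iq]; first by rewrite tpermL.
    rewrite tpermD//; first by rewrite eq_sym fa.
    by rewrite /b (inj_eq fi) eq_sym.
  rewrite mulmxA bs_block_diag// -!mulmxA E unlift_none; congr (_ *m (Phi _ *m _)).
  by apply/funext => k; rewrite liftK.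
Qed.

(** Induction on the sum of the entries: an entry just after an unselected row can be lowered; if
    there is none, the image is an initial segment. *)
Lemma bott_samelson_exists f : injective f -> exists l Phi, @bott_samelson f l Phi.
Proof.
have [N] := ubnP (\sum_q f q)%N; elim: N f => // N IHN f fN fi.
have [[q [a [ab fa]]]|nstep] := pselect (exists q (a : 'I_n),
    f q = a.+1 :> nat /\ forall i, f i != a).
  have f'i : injective (repl f q a).
    move=> i j; rewrite /repl; case: eqP => [->|_]; case: eqP => [->|_] //.
    - by move=> /esym /eqP; rewrite (negbTE (fa _)).
    - by move=> /eqP; rewrite (negbTE (fa _)).
    - exact: fi.
  have [|l [Phi BS]] := IHN (repl f q a) _ f'i.
    rewrite ltnS in fN; apply: leq_trans fN.
    rewrite (bigD1 q)//= [X in (_ < X)%N](bigD1 q)//= ab addSn ltnS.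
    by rewrite /repl eqxx leq_add2l leq_sum// => i /negbTE ->.
  by exists l.+1; eexists; exact: (bott_samelson_step fi ab fa BS).
exists 0%N; eexists; apply: bott_samelson_base => // q a ab.
apply: contrapT => /forallNP na; apply: nstep; exists q, a; split=> // i.
exact/eqP/na.
Qed.

End BottSamelson.

(** * The ball and the polydisk *)

Section PolarCoordinates.
Variable R : realType.
Local Open Scope complex_scope.
Local Notation C := (Cplx R).

Lemma cvg_real_complex (T : Type) (F : set_system T) (FF : Filter F)
  (f : T -> R) (a : R) : f @ F --> a -> (fun x => (f x)%:C : C) @ F --> (a%:C : C).
Proof.
move=> fa; apply/cvgrPdist_lt => e e0.
have eE : (complex.Re e)%:C = e by rewrite RRe_real// gtr0_real.
have re0 : 0 < complex.Re e by move: e0; rewrite -eE ltcR.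
near=> y; rewrite -rmorphB/= -eE.
rewrite normc_def/= expr0n addr0 sqrtr_sqr ltcR.
near: y; have /cvgrPdist_lt/(_ _ re0) := fa; exact.
Unshelve. all: by end_near. Qed.

Lemma cont_real_complex (T : topologicalType) (f : T -> R) :
  continuous f -> continuous (fun x => (f x)%:C : C).
Proof. by move=> cf x; exact: (cvg_real_complex _ (cf x)). Qed.

Lemma cont_bigmax (T : topologicalType) (I : Type) (r : seq I) (F : I -> T -> R) :
  (forall i, continuous (F i)) ->
  continuous (fun x => \big[Num.max/0]_(i <- r) F i x).
Proof.
move=> cF; elim: r => [|j r IHr].
  by under eq_fun do rewrite big_nil; exact: cont_cst.
under eq_fun do rewrite big_cons maxr_absE.
apply: contM; last exact: cont_cst.
apply: contD; first exact: contD.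
exact/cont_norm/(contD (cF j))/contN.
Qed.

(** The norm on [C] takes values in [C]; square roots and maxima are taken in [R]. *)
Definition rmod (z : C) : R := complex.Re `|z|.

Lemma rmodE z : (rmod z)%:C = `|z|.
Proof. by rewrite RRe_real// normr_real. Qed.

Lemma rmod_ge0 z : 0 <= rmod z.
Proof. by have := normr_ge0 z; rewrite -rmodE lecR. Qed.

Lemma rmodM z w : rmod (z * w) = rmod z * rmod w.
Proof. by apply: complexI; rewrite rmorphM/= !rmodE normrM. Qed.

Lemma rmod_real (x : R) : rmod x%:C = `|x|.
Proof. by rewrite /rmod normc_def/= expr0n addr0 sqrtr_sqr. Qed.

Lemma rmod_eq0 z : (rmod z == 0) = (z == 0).
Proof. by rewrite -(inj_eq (@complexI _)) rmodE normr_eq0. Qed.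

Lemma rmod_lt1 z : (`|z| < 1) = (rmod z < 1).
Proof. by rewrite -rmodE -(ltcR _ 1). Qed.

Lemma rmod_le1 z : (`|z| <= 1) = (rmod z <= 1).
Proof. by rewrite -rmodE -(lecR _ 1). Qed.

Variable l : nat.
Implicit Types z u chi : 'I_l -> C.

Definition vnorm z : R := Num.sqrt (\sum_k rmod (z k) ^+ 2).
Definition vmax z : R := \big[Num.max/0]_k rmod (z k).

Lemma vnorm_ge0 z : 0 <= vnorm z.
Proof. exact: sqrtr_ge0. Qed.

Lemma vmax_ge0 z : 0 <= vmax z.
Proof. exact: bigmax_ge_id. Qed.

Lemma rmod_le_vmax z k : rmod (z k) <= vmax z.
Proof. exact: le_bigmax. Qed.

Lemma vnormZ (c : R) z : 0 <= c -> vnorm (fun k => c%:C * z k) = c * vnorm z.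
Proof.
move=> c0; transitivity (Num.sqrt (c ^+ 2) * vnorm z); last first.
  by rewrite sqrtr_sqr ger0_norm.
rewrite /vnorm -sqrtrM ?sqr_ge0// mulr_sumr.
by congr Num.sqrt; apply: eq_bigr => k _; rewrite rmodM rmod_real exprMn real_normK ?num_real.
Qed.

Lemma vmaxZ (c : R) z : 0 <= c -> vmax (fun k => c%:C * z k) = c * vmax z.
Proof.
move=> c0; rewrite /vmax; elim/big_ind2 : _ => [|x1 x2 y1 y2 -> ->|k _].
- by rewrite mulr0.
- by rewrite maxr_pMr.
- by rewrite rmodM rmod_real ger0_norm.
Qed.

Lemma vmax_eq0 z : vmax z = 0 <-> forall k, z k = 0.
Proof.
split=> [z0 k|z0].
  by apply/eqP; rewrite -rmod_eq0 eq_le rmod_ge0 andbT -z0 rmod_le_vmax.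
apply/eqP; rewrite eq_le vmax_ge0 andbT; apply/bigmax_leP; split=> // k _.
by rewrite z0 (rmod_real 0) normr0.
Qed.

Lemma vnorm_eq0 z : vnorm z = 0 <-> forall k, z k = 0.
Proof.
rewrite /vnorm; split=> [/eqP|z0]; last first.
  by rewrite big1 ?sqrtr0// => k _; rewrite z0 (rmod_real 0) normr0 expr0n.
rewrite sqrtr_eq0 => s0 k; have : \sum_k rmod (z k) ^+ 2 == 0.
  by rewrite eq_le s0 sumr_ge0// => i _; exact: sqr_ge0.
rewrite psumr_eq0; last by move=> i _; exact: sqr_ge0.
by move=> /allP/(_ k (mem_index_enum _)); rewrite sqrf_eq0 rmod_eq0 => /eqP.
Qed.

(* Radial rescaling of the ball onto the polydisk; at the origin the factor is
   0 / 0 = 0. *)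
Definition to_polydisk z : 'I_l -> C := fun k => (vnorm z / vmax z)%:C * z k.
Definition of_polydisk z : 'I_l -> C := fun k => (vmax z / vnorm z)%:C * z k.

Lemma vmax_to_polydisk z : vmax (to_polydisk z) = vnorm z.
Proof.
rewrite vmaxZ ?divr_ge0 ?vmax_ge0 ?vnorm_ge0//.
have [/vmax_eq0 z0|z0] := eqVneq (vmax z) 0; last by rewrite divfK.
by rewrite (vnorm_eq0 z).2// !mul0r.
Qed.

Lemma vnorm_of_polydisk z : vnorm (of_polydisk z) = vmax z.
Proof.
rewrite vnormZ ?divr_ge0 ?vmax_ge0 ?vnorm_ge0//.
have [/vnorm_eq0 z0|z0] := eqVneq (vnorm z) 0; last by rewrite divfK.
by rewrite (vmax_eq0 z).2// !mul0r.
Qed.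

Lemma to_polydiskK z k : of_polydisk (to_polydisk z) k = z k.
Proof.
rewrite /of_polydisk vmax_to_polydisk.
rewrite vnormZ ?divr_ge0 ?vmax_ge0 ?vnorm_ge0//.
have [/vmax_eq0 z0|z0] := eqVneq (vmax z) 0; first by rewrite /to_polydisk z0 !mulr0.
have n0 : vnorm z != 0 by apply: contra_neq z0 => /vnorm_eq0 ?; exact/vmax_eq0.
rewrite /to_polydisk mulrA -rmorphM/=.
have -> : vnorm z / (vnorm z / vmax z * vnorm z) * (vnorm z / vmax z) = 1.
  by field; rewrite n0 z0.
by rewrite mul1r.
Qed.

Lemma of_polydiskK z k : to_polydisk (of_polydisk z) k = z k.
Proof.
rewrite /to_polydisk vnorm_of_polydisk.
rewrite vmaxZ ?divr_ge0 ?vmax_ge0 ?vnorm_ge0//.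
have [/vmax_eq0 z0|z0] := eqVneq (vmax z) 0; first by rewrite /of_polydisk z0 !mulr0.
have n0 : vnorm z != 0 by apply: contra_neq z0 => /vnorm_eq0 ?; exact/vmax_eq0.
rewrite /of_polydisk mulrA -rmorphM/=.
have -> : vmax z / (vmax z / vnorm z * vmax z) * (vmax z / vnorm z) = 1.
  by field; rewrite n0 z0.
by rewrite mul1r.
Qed.

Lemma to_polydisk_phase chi z : (forall k, `|chi k| = 1) -> forall k,
  to_polydisk (fun k => chi k * z k) k = chi k * to_polydisk z k.
Proof.
move=> chi1 k; have r1 j : rmod (chi j * z j) = rmod (z j).
  by rewrite rmodM /rmod chi1 mul1r.
have -> : to_polydisk (fun k => chi k * z k) k =
    (vnorm (fun k => chi k * z k) / vmax (fun k => chi k * z k))%:C * (chi k * z k).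
  by [].
have -> : vnorm (fun k => chi k * z k) = vnorm z.
  by congr Num.sqrt; apply: eq_bigr => j _; rewrite r1.
have -> : vmax (fun k => chi k * z k) = vmax z.
  by apply: eq_bigr => j _; rewrite r1.
by rewrite mulrCA.
Qed.

Definition cplx (x : 'rV[R]_(l + l)) : 'I_l -> C :=
  fun k => (x 0 (lshift l k) +i* x 0 (rshift l k))%C.

Lemma vnorm_cplx x : vnorm (cplx x) = Num.sqrt (sqnorm x).
Proof.
congr Num.sqrt; rewrite /sqnorm big_split_ord/= -big_split/=.
apply: eq_bigr => k _; rewrite /rmod normc_def/= sqr_sqrtr//.
by rewrite addr_ge0 ?sqr_ge0.
Qed.

Lemma cplx_inj x y : cplx x =1 cplx y -> x = y.
Proof.
move=> xy; apply/rowP => p; rewrite -[p]splitK.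
by case: (fintype.split p) => k /=; have [] := xy k.
Qed.

Lemma cplx_surj z : exists x, cplx x =1 z.
Proof.
exists (row_mx (\row_k complex.Re (z k)) (\row_k complex.Im (z k))) => k.
by rewrite /cplx row_mxEl row_mxEr !mxE; case: (z k).
Qed.

(** Away from the origin the radial factor is a continuous quotient. At the origin it need not have
    a limit, but the image has sup norm [vnorm], which tends to 0. *)
Lemma continuous_polydisk k : continuous (fun x => to_polydisk (cplx x) k).
Proof.
have cc i : continuous (fun x : 'rV[R]_(l + l) => x 0 i) by exact: coord_continuous.
have cn : continuous (fun x => vnorm (cplx x)).
  move=> x; under eq_fun do rewrite vnorm_cplx.
  apply: (@continuous_comp _ _ _ (@sqnorm R (l + l)) Num.sqrt); last exact: sqrt_continuous.
  move: x; apply: (@cont_sum R) => i; under eq_fun do rewrite expr2; exact: contM.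
have cr j : continuous (fun x => rmod (cplx x j)).
  move=> x; under eq_fun do rewrite /rmod normc_def/=.
  apply: (@continuous_comp _ _ _ (fun x : 'rV[R]_(l + l) => _) Num.sqrt); last exact: sqrt_continuous.
  by move: x; apply: contD; under eq_fun do rewrite expr2; exact: contM.
have cm : continuous (fun x => vmax (cplx x)) by exact: cont_bigmax.
have cz j : continuous (fun x => cplx x j).
  under eq_fun do rewrite [cplx _ _]complexE /=.
  apply: contD; first exact: cont_real_complex.
  by apply: contM; [exact: cont_cst|exact: cont_real_complex].
move=> x; have [x0|x0] := eqVneq (vmax (cplx x)) 0; last first.
  have q : (fun y => vnorm (cplx y) / vmax (cplx y)) @ x -->
      vnorm (cplx x) / vmax (cplx x).
    exact: (cvgM (cn x) (cvgV x0 (cm x))).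
  exact: (cvgM (cvg_real_complex (nbhs_filter x) q) (cz k x)).
have y0 : forall j, cplx x j = 0 by exact/vmax_eq0.
have t0 : to_polydisk (cplx x) k = 0 by rewrite /to_polydisk y0 mulr0.
have FF := nbhs_filter x; apply/cvgrPdist_le => e e0.
have eE : (complex.Re e)%:C = e by rewrite RRe_real// gtr0_real.
have re0 : 0 < complex.Re e by move: e0; rewrite -eE ltcR.
near=> y; rewrite t0 sub0r normrN -rmodE -eE lecR.
apply: le_trans (rmod_le_vmax _ _) _; rewrite vmax_to_polydisk.
have -> : vnorm (cplx y) = `|vnorm (cplx x) - vnorm (cplx y)|.
  have -> : vnorm (cplx x) = 0 by exact/vnorm_eq0.
  by rewrite sub0r normrN ger0_norm// vnorm_ge0.
by near: y; have /cvgrPdist_le/(_ _ re0) := cn x; exact.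
Unshelve. all: by end_near. Qed.

(** Complex multiplication by [chi] on row vectors with all real parts first and all imaginary parts
    last. *)
Definition phase_mx chi : 'M[R]_(l + l) :=
  let re := diag_mx (\row_k complex.Re (chi k)) in
  let im := diag_mx (\row_k complex.Im (chi k)) in block_mx re im (- im) re.

Lemma cplx_phase chi x k : cplx (x *m phase_mx chi) k = chi k * cplx x k.
Proof.
rewrite /cplx -[x]hsubmxK /phase_mx mul_row_block !row_mxEl !row_mxEr.
rewrite mulmxN !mul_mx_diag !mxE; case: (chi k) => a b.
by apply/eqP; rewrite eq_complex /=; apply/andP; split; apply/eqP; ring.
Qed.

Lemma sqnorm_phase chi x : (forall k, `|chi k| = 1) ->
  sqnorm (x *m phase_mx chi) = sqnorm x.
Proof.
move=> chi1; have e0 (y : 'rV[R]_(l + l)) : 0 <= sqnorm y.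
  by apply: sumr_ge0 => i _; exact: sqr_ge0.
rewrite -[LHS]sqr_sqrtr// -[RHS]sqr_sqrtr// -!vnorm_cplx; congr (Num.sqrt _ ^+ 2).
by apply: eq_bigr => k _; rewrite cplx_phase rmodM /rmod chi1 mul1r.
Qed.

Variables (c : nat) (chi : 'I_l -> C) (chic : forall k, chi k ^+ c.+1 = 1).

Definition phase_repr (g : 'I_c.+1) : 'M[R]_(l + l) :=
  phase_mx (fun k => chi k ^+ g).

Lemma phase_reprP : mx_repr [set: 'I_c.+1]%G phase_repr.
Proof.
have ext (M N : 'M[R]_(l + l)) :
    (forall x : 'rV_(l + l), cplx (x *m M) =1 cplx (x *m N)) -> M = N.
  by move=> MN; apply/row_matrixP => i; rewrite !rowE; exact/cplx_inj/MN.
split=> [|g h _ _]; apply: ext => x k.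
  by rewrite cplx_phase mulmx1 expr0 mul1r.
rewrite mulmxA !cplx_phase mulrA -exprD addnC; congr (_ * _).
by rewrite -[RHS](expr_mod (g + h) (chic k)).
Qed.

Definition phase_representation := MxRepresentation phase_reprP.

End PolarCoordinates.

(** * Attaching q-cells *)

Section TopologyLemmas.

Lemma continuous_to_set (T X : topologicalType) (A : set X) (f : T -> A) :
  continuous (fun x => val (f x)) -> continuous f.
Proof.
move=> /continuousP cf; apply/continuousP => U [V oV <-].
exact: (cf V oV).
Qed.

Lemma continuous_val (X : topologicalType) (A : set X) :
  continuous (val : A -> X).
Proof. exact: initial_continuous. Qed.

Lemma hausdorff_inj (S T : topologicalType) (f : S -> T) :
  continuous f -> injective f -> hausdorff_space T -> hausdorff_space S.
Proof.
move=> cf fi hT x y xy; apply/fi/hT => U V /cf fU /cf fV.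
by have [z [Uz Vz]] := xy _ _ fU fV; exists (f z).
Qed.

Lemma compact_set_type (X : topologicalType) (A : set X) :
  compact A -> compact [set: A].
Proof.
move=> cA F FF _; pose G : set_system X := fmap (val : A -> X) F.
have GA : G A.
  by apply: (@filterS _ F _ setT) => [x _|]; [exact: set_valP|exact: filterT].
have [p [Ap clp]] := cA G _ GA.
exists (exist _ p (mem_set Ap)); split=> // U V FU [W [[W' oW' <-] W'p WV]].
have GU : G (val @` U).
  by rewrite /G /fmap/=; apply: filterS FU => x Ux; exists x.
have [_ [[x Ux <-] W'x]] := clp _ _ GU (open_nbhs_nbhs (conj oW' W'p)).
by exists x; split=> //; apply: WV.
Qed.

Lemma compact_image (S T : topologicalType) (f : S -> T) (A : set S) :
  continuous f -> compact A -> compact (f @` A).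
Proof. by move=> cf; apply: continuous_compact; exact: continuous_subspaceT. Qed.

Lemma compact_homeomorphism (S T : topologicalType) (h : S -> T) :
  compact [set: S] -> hausdorff_space T -> continuous h -> injective h ->
  (forall y, exists x, h x = y) -> homeomorphism h.
Proof.
move=> cS hT ch hi hs; split=> //; have [g hg] := choice hs.
exists g; split=> // [|x]; last by apply: hi; rewrite hg.
apply/continuous_closedP => Z cZ.
have -> : g @^-1` Z = h @` Z.
  apply/seteqP; split=> [y Zy|_ [x Zx <-]]; first by exists (g y).
  by rewrite /preimage/= (_ : g (h x) = x)//; apply: hi; rewrite hg.
apply: compact_closed => //; apply: compact_image => //.
exact: subclosed_compact cZ cS _.
Qed.

(** For closed [Z] in [Q], the preimage under [e] is the trace of a closed, hence compact, subset of
    [K]. Its image under [f] is closed in [X] and meets [C] exactly in the image of [Z] under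
    [kappa]. *)
Lemma cell_homeomorphic (K X Q : topologicalType) (f : K -> X) (C : set X)
    (kappa : Q -> X) (e : f @^-1` C -> Q) :
  compact [set: K] -> hausdorff_space X -> continuous f ->
  continuous kappa -> injective kappa -> range kappa = C ->
  continuous e -> (forall q, exists v, e v = q) ->
  (forall v, kappa (e v) = f (val v)) -> homeomorphic Q C.
Proof.
move=> cK hX cf ck ki kC ce es ke.
have kin q : kappa q \in C by rewrite inE -kC; exists q.
pose h q : C := exist _ (kappa q) (kin q).
have hi : injective h by move=> x y /(congr1 val) /ki.
have hs y : exists x, h x = y.
  have sub : C `<=` range kappa by rewrite kC.
  have [q _ qy] := sub _ (set_valP y).
  by exists q; apply: val_inj.
have [g hg] := choice hs.
exists h; split; first exact: continuous_to_set.
exists g; split=> // [|x]; last by apply: hi; rewrite hg.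
apply/continuous_closedP => Z cZ.
have [W oW WZ] : open (e @^-1` (~` Z)).
  by move/continuousP: ce; apply; exact: closed_openC.
have cW : closed (f @` (~` W)).
  apply: compact_closed => //; apply: compact_image => //.
  by apply: (subclosed_compact _ cK) => //; exact: open_closedC.
suff -> : g @^-1` Z = val @^-1` (f @` (~` W)).
  by move/continuous_closedP: (@continuous_val X C); exact.
have memW v : W (val v) <-> ~ Z (e v).
  by have /seteqP[s1 s2] := WZ; split=> [/s1|/s2].
apply/seteqP; split=> [y Zy|y [v nW vy]].
  have [v ev] := es (g y); exists (val v).
    by move=> /memW; rewrite ev.
  by rewrite -ke ev -[y in RHS]hg.
have vC : v \in f @^-1` C by rewrite inE /preimage/= vy; exact: set_valP.
have Zv : Z (e (exist _ v vC)).
  by apply: contrapT => /(memW (exist _ v vC)).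
rewrite /preimage/= (_ : g y = e (exist _ v vC))//.
by apply: hi; rewrite hg; apply: val_inj; rewrite /= ke.
Qed.

End TopologyLemmas.

Section AttachQCell.
Variables (R : realType) (k : nat).

Lemma sqnorm_continuous : continuous (@sqnorm R k).
Proof.
apply: (@cont_sum R) => i; under eq_fun do rewrite expr2.
by apply: contM; exact: coord_continuous.
Qed.

Lemma compact_disk : compact (@disk R k).
Proof.
apply: bounded_closed_compact.
  exists 1; split=> // e e1 v v1; apply: ltW; apply: le_lt_trans e1.
  rewrite /Num.Def.normr/= mx_normrE; apply/bigmax_leP; split=> // -[i j] _ /=.
  rewrite ord1 -(@ler_pXn2r _ 2)// ?nnegrE// expr1n real_normK ?num_real//.
  by apply: le_trans v1; rewrite /sqnorm (bigD1 j)//= lerDl sumr_ge0// => ? _; exact: sqr_ge0.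
apply: (@preimage_closed _ _ (@sqnorm R k) [set x | x <= 1]); last exact: closed_le.
by move=> x _; exact: sqnorm_continuous.
Qed.

Variables (gT : finGroupType) (G : {group gT}) (rG : mx_representation R G k).
Variables (X : topologicalType) (A B : set X) (f : @disk R k -> X).
Hypotheses (hX : hausdorff_space X) (stab : disk_stable rG) (cf : continuous f).
Hypotheses (cA : compact A).
Hypothesis f_orbit : forall u v, disk_orbit rG u v -> f u = f v.
Hypothesis f_sphere : forall v, sqnorm (val v) = 1 -> A (f v).
Hypothesis f_ball : forall v, sqnorm (val v) <> 1 -> ~ A (f v).
Hypothesis f_inj : forall u v, sqnorm (val u) <> 1 -> f u = f v -> disk_orbit rG u v.
Hypothesis BE : B = A `|` range f.

(** The inclusion of [A] and the map induced by [f] on the orbit space combine into a bijection from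
    the adjunction space: interior points are separated by [f_inj], and boundary points are already
    glued to [A]. *)
Lemma attach_qcellI : attach_qcell R A B.
Proof.
pose fb : qdisk rG -> X := f \o repr.
have fb_pi v : fb (\pi_(qdisk rG) v) = f v.
  by apply/f_orbit; apply/eqmodP; rewrite reprK.
have cfb : continuous fb.
  apply: repr_comp_continuous => // u v /eqP uv; apply/eqP/f_orbit.
  exact/eqmodP.
have sphA (q : qsphere rG) : fb (val q) \in A.
  by rewrite inE; have := valP q; rewrite inE => -[v v1 <-]; rewrite fb_pi; exact: f_sphere.
pose phi (q : qsphere rG) : A := exist _ (fb (val q)) (sphA q).
have cphi : continuous phi.
  apply: continuous_to_set => q.
  exact: continuous_comp (@continuous_val _ _ q) (cfb _).
pose XY := {b : bool & pair_family A (qdisk rG) b}.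
pose H (p : XY) : X := match p with
  | existT true x => val (x : A) | existT false y => fb y end.
have Hglue p : H (Defs.glue phi p) = H p.
  by case: p => -[x|y] //=; case: pselect.
have HB p : H p \in B.
  rewrite inE BE; case: p => -[x|y] /=; first by left; exact: set_valP.
  by right; exists (repr y).
pose H' (p : XY) : B := exist _ (H p) (HB p).
have cH' : continuous H'.
  apply: continuous_to_set; apply/continuousP => U oU; apply/sigT_openP => -[].
    by move/continuousP: (@continuous_val _ A) => /(_ U oU).
  by move/continuousP: cfb => /(_ U oU).
have repr_glue p : Defs.glue phi (repr (\pi_(adjunction phi) p)) = Defs.glue phi p.
  have : \pi_(adjunction phi) (repr (\pi_(adjunction phi) p)) = \pi_(adjunction phi) p.
    by rewrite reprK.
  by move=> /eqmodP/asboolP.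
pose h : adjunction phi -> B := H' \o repr.
have h_pi p : val (h (\pi_(adjunction phi) p)) = H p.
  by rewrite /= -Hglue repr_glue Hglue.
have sph_pi (y : qdisk rG) : A (fb y) -> y \in qsphere rG.
  move=> Ay; rewrite inE; exists (repr y); last exact: reprK.
  by apply: contrapT => /f_ball; exact.
exists k, gT, G, rG, phi, h; split=> //.
  apply: compact_homeomorphism.
  - have -> : [set: adjunction phi] = range (\pi_(adjunction phi)).
      by apply/seteqP; split=> // q _; exists (repr q) => //; rewrite reprK.
    apply: compact_image; first exact: pi_continuous.
    apply: sigT_compact; first exact: finite_finset.
    case; first exact: compact_set_type.
    have -> : [set: qdisk rG] = range (\pi_(qdisk rG)).
      by apply/seteqP; split=> // q _; exists (repr q) => //; rewrite reprK.
    apply: compact_image; first exact: pi_continuous.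
    exact/compact_set_type/compact_disk.
  - exact: (hausdorff_inj (@continuous_val _ _) val_inj).
  - apply: repr_comp_continuous => // p q /eqP /eqmodP/asboolP pq.
    by apply/eqP/val_inj; rewrite /= -Hglue pq Hglue.
  - move=> x y hxy; rewrite -[x]reprK -[y]reprK; apply/eqmodP/asboolP.
    have {hxy} : H (repr x) = H (repr y) by move: hxy => /(congr1 val).
    move: (repr x) (repr y) => {x y} p q.
    (* A disk point sent into [A] lies on the sphere, so gluing has replaced it by its image. *)
    have glueA (p' : XY) (x : A) : val x = H p' ->
        Defs.glue phi p' = existT (pair_family A (qdisk rG)) true x.
      case: p' => -[x'|y] /= xE; first by congr existT; apply: val_inj.
      case: pselect => [Sy|[]]; first by congr existT; apply: val_inj.
      by apply: sph_pi; rewrite -xE; exact: set_valP.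
    move=> pq; have [Ap|nAp] := pselect (A (H p)).
      have [x xE] : exists x : A, val x = H p.
        by exists (exist (fun y => y \in A) _ (mem_set Ap)).
      by rewrite (glueA p x)// (glueA q x)// xE.
    have nAq : ~ A (H q) by rewrite -pq.
    case: p q pq nAp nAq => -[x|y] [[x'|y']] //=.
    - by move=> _ []; exact: set_valP.
    - by move=> _ []; exact: set_valP.
    - by move=> _ _ []; exact: (set_mem (valP x')).
    move=> yy' nAy _; suff -> : y = y' by [].
    rewrite -[y]reprK -[y']reprK; apply/eqmodP/f_inj => // /f_sphere.
    exact: nAy.
  - move=> b; have sub : B `<=` A `|` range f by rewrite BE.
    have [Ab|[v _ vb]] := sub _ (set_valP b).
      exists (\pi_(adjunction phi) (existT (pair_family A (qdisk rG)) true
        (exist (fun y => y \in A) _ (mem_set Ab)))).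
      by apply: val_inj; rewrite h_pi.
    exists (\pi_(adjunction phi) (existT (pair_family A (qdisk rG)) false (\pi_(qdisk rG) v))).
    by apply: val_inj; rewrite h_pi /= fb_pi.
by move=> x; rewrite h_pi.
Qed.

End AttachQCell.

(** * Weighted projective spaces *)

Section QuotientMaps.
Variables (T : topologicalType) (Q0 : quotType T).
Local Notation Q := (quotient_topology Q0).

(** The saturation of [U] is the union of its preimages under the continuous self-maps that preserve
    classes. *)
Lemma open_quotient_map :
  (forall x y, \pi_Q x = \pi_Q y -> exists f : T -> T,
    [/\ continuous f, f x = y & forall z, \pi_Q (f z) = \pi_Q z]) ->
  forall U : set T, open U -> open (\pi_Q @` U).
Proof.
move=> act U oU; rewrite /open/= /quotient_open.
pose D := [set f : T -> T | continuous f /\ forall z, \pi_Q (f z) = \pi_Q z].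
rewrite (_ : _ @^-1` _ = \bigcup_(f in D) f @^-1` U); last first.
  apply/seteqP; split=> [x [u Uu /esym /act[f [cf fx fpi]]]|x [f [cf fpi] Ufx]].
    by exists f => //; rewrite /preimage/= fx.
  by exists (f x).
by apply: bigcup_open => f [/continuousP cf _]; exact: cf.
Qed.

End QuotientMaps.

Section WeightedProjectiveHausdorff.
Variables (R : realType) (k : nat) (b : 'I_k.+1 -> nat).
Local Notation C := (Cplx R).
Hypothesis b_gt0 : forall i, (0 < b i)%N.

Lemma cont_comp (S T U : topologicalType) (f : S -> T) (g : T -> U) :
  continuous f -> continuous g -> continuous (fun x => g (f x)).
Proof. by move=> cf cg x; exact: continuous_comp (cf x) (cg (f x)). Qed.

Lemma cont_fst (S T : topologicalType) : continuous (@fst S T).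
Proof. by move=> x; exact: cvg_fst. Qed.

Lemma cont_snd (S T : topologicalType) : continuous (@snd S T).
Proof. by move=> x; exact: cvg_snd. Qed.

Lemma cont_exp (T : topologicalType) (K : numFieldType) (f : T -> K) m :
  continuous f -> continuous (fun x => f x ^+ m).
Proof.
move=> cf; elim: m => [|m IHm]; first by under eq_fun do rewrite expr0; exact: cont_cst.
by under eq_fun do rewrite exprS; exact: contM.
Qed.

Lemma cont_mx (T : topologicalType) (K : topologicalType) m p (f : T -> 'M[K]_(m, p)) :
  (forall i j, continuous (fun x => f x i j)) -> continuous f.
Proof.
move=> cf x U [P Pn PU].
have FF := nbhs_filter x.
have fP : nbhs x (fun y => forall i j, P i j (f y i j)).
  apply: filter_forall => i; apply: filter_forall => j.
  exact: (cf i j x _ (Pn i j)).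
by apply: (filterS _ fP) => y Py; exact: PU.
Qed.

Lemma cont_entry (T : topologicalType) (K : topologicalType) m p (f : T -> 'M[K]_(m, p)) i j :
  continuous f -> continuous (fun x => f x i j).
Proof.
move=> cf x U Uf; apply: (cf x [set M | U (M i j)]).
exists (fun i' j' => if (i' == i) && (j' == j) then U else setT) => [i' j'|M].
  by case: ifPn => [/andP[/eqP -> /eqP ->]//|_]; exact: filterT.
by move=> /(_ i j); rewrite !eqxx.
Qed.

Lemma nonzero_vecP (z : nonzero_vec R k) : val z != 0.
Proof. exact: (@set_valP _ (nonzero_vec R k) z). Qed.

Definition wp_act (t : C) (z : nonzero_vec R k) : nonzero_vec R k :=
  insubd z (\row_i (t ^+ b i * val z 0 i)).

Lemma val_wp_act t z : t != 0 -> val (wp_act t z) = \row_i (t ^+ b i * val z 0 i).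
Proof.
move=> t0; rewrite val_insubd; case: ifPn => // /negP[].
apply/mem_set; apply: contra_neq (nonzero_vecP z) => /rowP z0.
apply/rowP => i; have := z0 i; rewrite !mxE => /eqP.
by rewrite mulf_eq0 expf_eq0 (negbTE t0) andbF => /eqP.
Qed.

Lemma wp_pi_open (U : set (nonzero_vec R k)) : open U -> open (wp_pi b @` U).
Proof.
apply: open_quotient_map => x y /eqmodP/asboolP[t t0 xy].
exists (wp_act t); split.
- apply: continuous_to_set; under eq_fun do rewrite val_wp_act//.
  apply: cont_mx => i j; under eq_fun do rewrite mxE.
  by apply: contM; [exact: cont_cst|apply: cont_entry; exact: continuous_val].
- by apply/val_inj/rowP => i; rewrite val_wp_act// mxE xy.
- move=> z; apply/esym/eqmodP/asboolP; exists t => // i.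
  by rewrite val_wp_act// mxE.
Qed.

Lemma compact_square (r : R) : exists K : set C,
  compact K /\ forall t : C, `|t| <= (r%:C)%C -> K t.
Proof.
pose sq := `[- r, r]%classic `*` `[- r, r]%classic.
pose f (x : R * R) : C := (x.1%:C)%C + 'i * (x.2%:C)%C.
have csq : compact sq by apply: compact_setX; exact: segment_compact.
exists (f @` sq); split.
  apply: compact_image csq.
  apply: contD; first by apply: cont_real_complex => x; exact: cvg_fst.
  apply: contM; first exact: cont_cst.
  by apply: cont_real_complex => x; exact: cvg_snd.
move=> t tr; exists (complex.Re t, complex.Im t); last by rewrite /f/= {3}[t]complexE.
have {}tr : Num.sqrt (complex.Re t ^+ 2 + complex.Im t ^+ 2) <= r.
  by move: tr; rewrite normc_def lecR.
split; rewrite /= in_itv/= -ler_norml; apply: le_trans tr; rewrite -sqrtr_sqr.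
  by rewrite ler_sqrt ?lerDl ?addr_ge0 ?sqr_ge0.
by rewrite ler_sqrt ?lerDr ?addr_ge0 ?sqr_ge0.
Qed.

(** A nonzero coordinate of [z] bounds the scalars relating points near [z] and [z']. The value
    [t = 0] may be added, since positive weights would make it force [z' = 0]; a compact set of
    scalars is then excluded on one neighbourhood. *)
Lemma wp_hausdorff : hausdorff_space (@WP R k b).
Proof.
move=> p q pq; rewrite -[p]reprK -[q]reprK; set z := repr p; set z' := repr q.
apply: contrapT => nzz'.
have neq (t : C) : exists i, t ^+ b i * val z 0 i != val z' 0 i.
  apply: contrapT => /forallNP tz; apply: nzz'; apply/eqmodP/asboolP; exists t.
    apply: contra_neq (nonzero_vecP z') => t0.
    apply/rowP => i; have /negP := tz i; rewrite negbK => /eqP <-.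
    by rewrite t0 expr0n eqn0Ngt b_gt0 mul0r mxE.
  by move=> i; have /negP := tz i; rewrite negbK => /eqP.
have [i0 zi0] : exists i, val z 0 i != 0.
  apply: contrapT => /forallNP z0; case/eqP: (nonzero_vecP z).
  by apply/rowP => i; have /negP := z0 i; rewrite negbK mxE => /eqP.
have zi_gt0 : 0 < `|val z 0 i0| / 2 by rewrite divr_gt0// normr_gt0.
(* If [|t| > rho], the i0-th coordinate, still at least half that of [z] in modulus, is scaled
   beyond [|z'| + 1]. The summand 1 ensures [|t| <= |t| ^+ b i0]. *)
pose rho : C := 1 + (`|val z' 0 i0| + 1) / (`|val z 0 i0| / 2).
have rho_ge1 : 1 <= rho by rewrite lerDl divr_ge0// ?ltW// addr_ge0.
have rhoE : ((complex.Re rho)%:C)%C = rho.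
  by rewrite RRe_real// ger0_real// (le_trans ler01).
have [K [cK Kr]] := compact_square (complex.Re rho).
have cz i : continuous (fun x : nonzero_vec R k => val x 0 i : C).
  by apply: cont_entry; exact: continuous_val.
pose NN := (nonzero_vec R k * nonzero_vec R k)%type.
pose P (uv : NN) (t : C) := exists i, t ^+ b i * val uv.1 0 i != val uv.2 0 i.
have near1 : \forall uv \near nbhs (z, z'), K `<=` P uv.
  apply: ((compact_near_coveringP K).1 cK NN (nbhs (z, z')) P (nbhs_filter (z, z'))).
  move=> t _; have [i ti] := neq t.
  pose F (x : C * NN) := x.1 ^+ b i * val x.2.1 0 i - val x.2.2 0 i.
  have cF : continuous F.
    have c1 := @cont_fst C NN; have c2 := @cont_snd C NN.
    have c3 := @cont_fst (nonzero_vec R k) (nonzero_vec R k).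
    have c4 := @cont_snd (nonzero_vec R k) (nonzero_vec R k).
    have c5 := cont_comp (cont_comp c2 c3) (cz i).
    have c6 := cont_comp (cont_comp c2 c4) (cz i).
    exact: (contD (contM (@cont_exp _ _ _ (b i) c1) c5) (contN c6)).
  have F0 : F (t, (z, z')) != 0 by rewrite subr_eq0.
  have nF : nbhs (F (t, (z, z'))) [set x | x != 0].
    exists `|F (t, (z, z'))|; first by rewrite /= normr_gt0.
    by move=> y /=; apply: contraTneq => ->; rewrite subr0 ltxx.
  case: (cF (t, (z, z')) _ nF) => -[Q1 Q2] [q1 q2] Q12.
  exists (Q1, Q2) => // -[t' uv] /Q12; rewrite /preimage/= subr_eq0 => neq'.
  by exists i.
pose U2 := [set u : nonzero_vec R k | `|val z 0 i0| / 2 < `|val u 0 i0| ].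
pose V2 := [set v : nonzero_vec R k | `|val v 0 i0| < `|val z' 0 i0| + 1 ].
have near2 : nbhs z U2.
  apply: (cz i0 z [set x | `|val z 0 i0| / 2 < `|x| ]).
  exists (`|val z 0 i0| / 2) => //= x /= zx.
  have := le_lt_trans (lerB_dist _ _) zx.
  by rewrite ltrBlDr -ltrBlDl {1}[`|val z 0 i0|](splitr) addrK.
have near3 : nbhs z' V2.
  apply: (cz i0 z' [set x | `|x| < `|val z' 0 i0| + 1]).
  exists 1 => //= x /=; rewrite distrC => zx.
  by rewrite -ltrBlDl; exact: le_lt_trans (lerB_dist _ _) zx.
have nbhs_pi x (U : set (nonzero_vec R k)) : nbhs x U -> nbhs (wp_pi b x) (wp_pi b @` U).
  rewrite nbhsE => -[U' [oU' U'x] U'U].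
  have FF := nbhs_filter (wp_pi b x).
  apply: (@filterS _ _ _ (wp_pi b @` U')); first by move=> _ [y /U'U Uy <-]; exists y.
  by apply: open_nbhs_nbhs; split; [exact: wp_pi_open|exists x].
case: near1 => -[U V] /= [Uz Vz'] UV.
have nU : nbhs (wp_pi b z) (wp_pi b @` (U `&` U2)) by apply: nbhs_pi; exact: filterI.
have nV : nbhs (wp_pi b z') (wp_pi b @` (V `&` V2)) by apply: nbhs_pi; exact: filterI.
have pz : wp_pi b z = p by exact: reprK.
have qz : wp_pi b z' = q by exact: reprK.
rewrite pz in nU; rewrite qz in nV.
have [_ [[u [Uu u2] <-] [v [Vv v1] /esym]]] := pq _ _ nU nV.
move=> /eqmodP/asboolP[t t0 uv].
have Kt : K t.
  apply: Kr; rewrite rhoE; rewrite real_leNgt ?normr_real ?ger0_real ?(le_trans ler01)//.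
  apply/negP => rt; have t1 := le_trans rho_ge1 (ltW rt).
  move: v1; rewrite /V2/= uv normrM normrX => v1.
  have : rho * (`|val z 0 i0| / 2) < `|val z' 0 i0| + 1.
    apply: le_lt_trans v1; apply: ler_pM; [exact: le_trans rho_ge1|exact: ltW| |exact: ltW].
    by apply: le_trans (ltW rt) _; rewrite ler_eXnr.
  by rewrite /rho mulrDl mul1r divfK ?gt_eqF// gtrDr (lt_gtF zi_gt0).
have [j] := UV (u, v) (conj Uu Vv) t Kt.
by rewrite -uv eqxx.
Qed.

End WeightedProjectiveHausdorff.

(** * The Grassmannian *)

Section Grassmannian.
Variables (R : realType) (n d : nat).
Local Notation C := (Cplx R).
Local Notation FR := (full_rank R n d).
Implicit Types (A B : FR) (l : schubert n d).

Lemma full_rankP A : \rank (val A) = d.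
Proof. exact: (@set_valP _ (full_rank R n d) A). Qed.

Definition mkfr (M : 'M[C]_(n, d)) (rM : \rank M = d) : FR :=
  exist (fun M => M \in full_rank R n d) M (mem_set rM).

Lemma rank_mulr (M : 'M[C]_(n, d)) (T : 'M[C]_d) : T \in unitmx ->
  \rank (M *m T) = \rank M.
Proof. by move=> uT; rewrite mxrankMfree// row_free_unit. Qed.

Lemma pi_GrP A B : \pi_(Gr R n d) A = \pi_(Gr R n d) B <->
  exists2 T, T \in unitmx & val B = val A *m T.
Proof.
split=> [/eqmodP /andP[_ /submxP[D BE]]|[T uT BE]].
  exists D^T; last by rewrite -[LHS]trmxK BE trmx_mul trmxK.
  rewrite unitmx_tr -row_free_unit -row_leq_rank.
  by rewrite -[X in (X <= _)%N](full_rankP B) -mxrank_tr BE mxrankM_maxl.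
apply/eqmodP; rewrite /= /same_colspace BE trmx_mul submxMl andbT.
by apply/submxP; exists (invmx T)^T; rewrite -!trmx_mul mulmxK.
Qed.

Lemma pi_Gr_nrm A B l (k : C) : pl (val A) (entry l) != 0 -> k != 0 ->
    (forall l', pl (val B) (entry l') = k * pl (val A) (entry l')) ->
  \pi_(Gr R n d) A = \pi_(Gr R n d) B.
Proof.
move=> A0 k0 AB; have B0 : pl (val B) (entry l) != 0 by rewrite AB mulf_neq0.
have uA := rowsub_unit A0; have uB := rowsub_unit B0.
apply/pi_GrP; exists (invmx (rowsub (entry l) (val A)) *m rowsub (entry l) (val B)).
  by rewrite unitmx_mul unitmx_inv uA uB.
rewrite mulmxA -[X in X *m _ *m _](nrmK A0) mulmxK// (eq_pl_colspace A0 k0 AB).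
by rewrite nrmK.
Qed.

Lemma schubert_cellP A l : schubert_cell l (\pi_(Gr R n d) A) <-> incell (val A) (entry l).
Proof.
have : \pi_(Gr R n d) A = \pi_(Gr R n d) (repr (\pi_(Gr R n d) A)) by rewrite reprK.
move=> /pi_GrP[T uT E]; have dT : \det T != 0 by rewrite -unitfE -unitmxE.
have plE f : (pl (val (repr (\pi_(Gr R n d) A))) f != 0) = (pl (val A) f != 0).
  by rewrite E pl_mulr mulf_eq0 (negbTE dT) orbF.
have := incell_flagP l (full_rankP (repr (\pi_(Gr R n d) A))).
rewrite /schubert_cell /dim_flag /= /flagdim => <-.
split=> -[A0 Ag]; split.
- by rewrite -plE.
- by move=> g g0; apply: Ag; rewrite plE.
- by rewrite plE.
- by move=> g g0; apply: Ag; rewrite -plE.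
Qed.

Definition mulr_fr (T : 'M[C]_d) A : FR := insubd A (val A *m T).

Lemma val_mulr_fr T A : T \in unitmx -> val (mulr_fr T A) = val A *m T.
Proof.
move=> uT; rewrite val_insubd; case: ifPn => // /negP[].
by apply/mem_set; rewrite /full_rank/= rank_mulr// full_rankP.
Qed.

Lemma pi_Gr_open (U : set FR) : open U -> open (\pi_(Gr R n d) @` U).
Proof.
apply: open_quotient_map => x y /pi_GrP[T uT yE].
exists (mulr_fr T); split.
- apply: continuous_to_set; under eq_fun do rewrite val_mulr_fr//.
  apply: cont_mx => i j; under eq_fun do rewrite mxE.
  apply: cont_sum => k; apply: contM; last exact: cont_cst.
  by apply: cont_entry; exact: continuous_val.
- by apply/val_inj; rewrite val_mulr_fr// yE.
- by move=> z; apply/esym/pi_GrP; exists T => //; rewrite val_mulr_fr.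
Qed.

End Grassmannian.

Section ScaleColumn.
Variables (F : fieldType) (n d : nat) (q0 : 'I_d).

(** Only one column is scaled, so that every minor is multiplied by [c] and not by [c ^+ d]. *)
Definition sc_mx (c : F) : 'M[F]_d := diag_mx (\row_q if q == q0 then c else 1).

Lemma det_sc_mx c : \det (sc_mx c) = c.
Proof.
rewrite det_diag (bigD1 q0)//= mxE eqxx big1 ?mulr1// => q qq.
by rewrite mxE (negbTE qq).
Qed.

Lemma sc_mx_unit c : c != 0 -> sc_mx c \in unitmx.
Proof. by rewrite unitmxE det_sc_mx unitfE. Qed.

End ScaleColumn.

(** * Weighted orbits *)

(** Applied with [K = |k|], [X = |x|] and [N] a norm: normalizing the phase and the norm removes a
    common factor [k]. *)
Lemma phase_quotient_scale (F : fieldType) (k K x X y N : F) :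
  k != 0 -> K != 0 -> x != 0 -> N != 0 ->
  K * X / (k * x) / (K * N) * (k * y) = X / x / N * y.
Proof. by move=> *; field; apply/and4P. Qed.

Lemma scale_ratio (F : fieldType) (k k' x y z : F) : k' != 0 ->
  k' * y = z * (k * x) -> y = k'^-1 * k * (z * x).
Proof. by move=> k0 /(canRL (mulKf k0)) ->; rewrite [z * _]mulrCA -mulrA. Qed.

(** With positive exponents, [|t| < 1] strictly shrinks the sum and [|t| > 1] strictly enlarges
    it. *)
Lemma weighted_sum_norm (K : numDomainType) (I : finType) (c : I -> nat)
    (z : I -> K) (t : K) : (forall i, (0 < c i)%N) -> 0 < \sum_i `|z i| ->
  \sum_i `|t ^+ c i * z i| = \sum_i `|z i| -> `|t| = 1.
Proof.
move=> c0 z0 E; have : `|t| \is Num.real by exact: normr_real.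
case/(real_ltgtP (real1 _)) => // t1.
  have : `|t| * (\sum_i `|z i|) <= \sum_i `|t ^+ c i * z i|.
    rewrite mulr_sumr; apply: ler_sum => i _; rewrite normrM normrX ler_wpM2r//.
    by rewrite ler_eXnr ?c0// ltW.
  by rewrite E ger_pMl// => /(lt_le_trans t1); rewrite ltxx.
have : \sum_i `|t ^+ c i * z i| <= `|t| * (\sum_i `|z i|).
  rewrite mulr_sumr; apply: ler_sum => i _; rewrite normrM normrX ler_wpM2r//.
  by rewrite ler_iXnr ?c0// ltW.
by rewrite E ler_pMl// => h; have := le_lt_trans h t1; rewrite ltxx.
Qed.

Section WeightedOrbits.
Variables (R : realType) (n d : nat) (d_gt0 : (0 < d)%N).
Variables (w : 'I_n -> nat) (a : nat) (a_gt0 : (0 < a)%N).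
Variables (m : nat) (lam : 'I_m.+1 -> schubert n d).
Hypotheses (lam_bij : bijective lam).
Hypothesis lam_mono : forall i j, schubert_le (lam i) (lam j) -> (i <= j)%N.
Local Notation C := (Cplx R).
Local Notation FR := (full_rank R n d).
Local Notation c_ i := (cnum lam w a i).
Implicit Types (A B : FR) (i j : 'I_m.+1) (t : C).

Definition mnr A j : C := minor lam (val A) j.

Definition sig j : nat := (\sum_(q < d) w (entry (lam j) q))%N.

Definition nrm1 A : C := \sum_j `|mnr A j|.

(** The common form of both quotient relations, by [weq_related] and [wp_pi_pluecker]. *)
Definition related t A B : Prop := forall j, mnr B j = t ^+ c_ j * mnr A j.

Definition cellset i : set FR :=
  [set A | mnr A i != 0 /\ forall j, (i < j)%N -> mnr A j = 0].

Lemma lam_surj l : exists j, lam j = l.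
Proof. by case: lam_bij => g _ gK; exists (g l); rewrite gK. Qed.

Lemma c_gt0 j : (0 < c_ j)%N.
Proof. by rewrite ltn_addr. Qed.

Lemma nrm1_gt0 A : 0 < nrm1 A.
Proof.
have [l] := rank_pl (full_rankP A); have [j <-] := lam_surj l => Aj.
by rewrite /nrm1 (bigD1 j)//= ltr_pwDl ?normr_gt0// sumr_ge0.
Qed.

(** The total order refines the entrywise one, so the last nonzero minor is a maximal one and
    [incell_max] applies. *)
Lemma cellsetP i A : cellset i A <-> incell (val A) (entry (lam i)).
Proof.
split=> [[Ai Aj]|Ai].
  apply: incell_max => // g /pl_sort[l [s [gE Al]]] ig; have [j jl] := lam_surj l.
  move: gE Al; rewrite -jl => gE Alj.
  have gj e : cnt g e = cnt (entry (lam j)) e by rewrite (cnt_eq _ gE) cnt_perm.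
  have ij : (i <= j)%N.
    by apply/lam_mono/cle_entryP => e; rewrite -gj.
  have ji : (j <= i)%N by rewrite leqNgt; apply: contra_neqN Alj; exact: Aj.
  have -> : i = j by apply/val_inj/anti_leq; rewrite ij ji.
  by move=> e; rewrite gj.
split; first exact: Ai.1.
move=> j ij; apply/eqP; apply: contraLR ij => /(incell_le Ai)/lam_mono.
by rewrite -leqNgt.
Qed.

Lemma mnr_mulr (T : 'M[C]_d) A B j : val B = val A *m T ->
  mnr B j = mnr A j * \det T.
Proof. by rewrite /mnr /minor => ->; exact: pl_mulr. Qed.

Lemma mnr_wscale t A j : t != 0 -> mnr (wscale w t A) j = t ^+ sig j * mnr A j.
Proof.
move=> t0; rewrite /mnr /minor val_wscale//.
have := pl_diag (\row_i t ^+ w i) (val A) (entry (lam j)); rewrite /pl => ->.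
congr (_ * _); rewrite /sig (big_morph (fun e => t ^+ e) (exprD t) (expr0 t)).
by apply: eq_bigr => q _; rewrite mxE.
Qed.

Lemma related_cellset t A B i : t != 0 -> related t A B -> cellset i A -> cellset i B.
Proof.
move=> t0 AB [Ai Aj]; split; first by rewrite AB mulf_neq0// expf_neq0.
by move=> j /Aj Aj0; rewrite AB Aj0 mulr0.
Qed.

Lemma related_norm t A B : related t A B -> nrm1 A = nrm1 B -> `|t| = 1.
Proof.
move=> AB nAB; apply: (weighted_sum_norm c_gt0 (nrm1_gt0 A)).
rewrite -/(nrm1 A) nAB; apply: eq_bigr => j _.
by rewrite AB.
Qed.

Lemma related_root t A B i : related t A B -> nrm1 A = nrm1 B ->
  0 < mnr A i -> 0 < mnr B i -> t ^+ c_ i = 1.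
Proof.
move=> AB nAB Ai Bi; have t1 := related_norm AB nAB.
have BA : mnr B i = mnr A i.
  have := congr1 Num.norm (AB i); rewrite normrM normrX t1 expr1n mul1r.
  by rewrite (gtr0_norm Ai) (gtr0_norm Bi).
by apply: (mulIf (lt0r_neq0 Ai)); rewrite -AB BA mul1r.
Qed.

Lemma root_norm t i : t ^+ c_ i = 1 -> `|t| = 1.
Proof.
move=> t1; apply: (@pexpIrn _ (c_ i)); rewrite ?c_gt0 ?nnegrE//.
by rewrite -normrX t1 normr1 expr1n.
Qed.

Lemma root_neq0 t i : t ^+ c_ i = 1 -> t != 0.
Proof. by move=> /root_norm t1; rewrite -normr_eq0 t1 oner_neq0. Qed.

(** The factor [t ^+ a] of [t ^+ c_j] does not depend on [j] and joins [k]; what remains is the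
    action of [t] on the minors. *)
Lemma root_act t A B i (k : C) : mnr A i != 0 -> k != 0 -> t ^+ c_ i = 1 ->
  (forall j, mnr B j = k * (t ^+ c_ j * mnr A j)) ->
  \pi_(Gr R n d) B = \pi_(Gr R n d) (wscale w t A).
Proof.
move=> Ai k0 t1 AB; have t0 := root_neq0 t1; apply/esym.
apply: (@pi_Gr_nrm _ _ _ _ _ (lam i) (k * t ^+ a)).
- by rewrite -[pl _ _]/(mnr _ i) mnr_wscale// mulf_neq0// expf_neq0.
- by rewrite mulf_neq0// expf_neq0.
move=> l'; have [j <-] := lam_surj l'; rewrite -![pl _ _]/(mnr _ j).
by rewrite AB mnr_wscale// exprD -!mulrA.
Qed.

Definition scal (c : C) A : FR := mulr_fr (sc_mx (Ordinal d_gt0) c) A.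

Lemma mnr_scal c A j : c != 0 -> mnr (scal c A) j = c * mnr A j.
Proof.
move=> c0; rewrite (@mnr_mulr (sc_mx (Ordinal d_gt0) c) A) ?det_sc_mx 1?mulrC//.
by rewrite val_mulr_fr// sc_mx_unit.
Qed.

Lemma nrm1_scal c A : c != 0 -> nrm1 (scal c A) = `|c| * nrm1 A.
Proof.
move=> c0; rewrite /nrm1 mulr_sumr; apply: eq_bigr => j _.
by rewrite mnr_scal// normrM.
Qed.

Lemma scal_cellset c A i : c != 0 -> cellset i (scal c A) <-> cellset i A.
Proof.
move=> c0; have E j : mnr (scal c A) j = c * mnr A j by exact: mnr_scal.
split=> -[Ai Aj]; split.
- by move: Ai; rewrite E mulf_eq0 negb_or => /andP[].
- by move=> j ij; apply: (mulfI c0); rewrite -E Aj// mulr0.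
- by rewrite E; exact: mulf_neq0.
- by move=> j ij; rewrite E Aj// mulr0.
Qed.

Lemma cont_mnr (T : topologicalType) (g : T -> FR) j :
  (forall p q, continuous (fun x => val (g x) p q)) -> continuous (fun x => mnr (g x) j).
Proof. by move=> cg; exact: cont_pl. Qed.

Lemma cont_nrm1 (T : topologicalType) (g : T -> FR) :
  (forall p q, continuous (fun x => val (g x) p q)) -> continuous (fun x => nrm1 (g x)).
Proof. by move=> cg; apply: cont_sum => j; apply: cont_norm; exact: cont_mnr. Qed.

Lemma cont_scal (T : topologicalType) (g : T -> FR) (c : T -> C) :
  (forall x, c x != 0) -> continuous c ->
  (forall p q, continuous (fun x => val (g x) p q)) -> continuous (fun x => scal (c x) (g x)).
Proof.
move=> c0 cc cg; apply: continuous_to_set; apply: cont_mx => p q.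
have -> : (fun x => val (scal (c x) (g x)) p q) =
    fun x => val (g x) p q * (if q == Ordinal d_gt0 then c x else 1).
  by apply/funext => x; rewrite val_mulr_fr ?sc_mx_unit// mul_mx_diag !mxE.
apply: (contM (cg p q)); case: eqP => _; [exact: cc|exact: cont_cst].
Qed.

(* Every weighted orbit in the i-th cell has a representative of norm 1 with
   positive i-th coordinate; it is unique up to c_i-th roots of unity. *)
Definition unit_lift i A : FR := scal (`|mnr A i| / mnr A i / nrm1 A) A.

Lemma unit_lift_factor i A : mnr A i != 0 -> `|mnr A i| / mnr A i / nrm1 A != 0.
Proof.
by move=> Ai; rewrite !mulf_neq0 ?invr_eq0 ?normr_eq0// gt_eqF// nrm1_gt0.
Qed.

Lemma unit_lift_mnr i A : mnr A i != 0 -> exists2 k, k != 0 &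
  forall j, mnr (unit_lift i A) j = k * mnr A j.
Proof.
move=> /unit_lift_factor kA; eexists; first exact: kA.
by move=> j; exact: mnr_scal.
Qed.

Lemma nrm1_unit_lift i A : mnr A i != 0 -> nrm1 (unit_lift i A) = 1.
Proof.
move=> Ai; rewrite nrm1_scal ?unit_lift_factor// !normrM !normfV normr_id.
rewrite divff ?normr_eq0// mul1r gtr0_norm ?nrm1_gt0// mulVf//.
by rewrite gt_eqF// nrm1_gt0.
Qed.

Lemma unit_lift_gt0 i A : mnr A i != 0 -> 0 < mnr (unit_lift i A) i.
Proof.
move=> Ai; rewrite mnr_scal ?unit_lift_factor// mulrAC divfK//.
by rewrite divr_gt0 ?normr_gt0// nrm1_gt0.
Qed.

Lemma unit_lift_wscale i t A j : mnr A i != 0 -> t != 0 ->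
  let M j' := t ^+ c_ j' * mnr A j' in
  mnr (unit_lift i (wscale w t A)) j = `|M i| / M i / (\sum_j' `|M j'|) * M j.
Proof.
move=> Ai t0 M; have ta0 : t ^+ a != 0 by exact: expf_neq0.
have ME j' : M j' = t ^+ a * mnr (wscale w t A) j'.
  by rewrite mnr_wscale// mulrA -exprD.
have Bi : mnr (wscale w t A) i != 0.
  by rewrite mnr_wscale//; apply: mulf_neq0 => //; exact: expf_neq0.
rewrite mnr_scal ?unit_lift_factor//.
have -> : \sum_j' `|M j'| = `|t ^+ a| * nrm1 (wscale w t A).
  by rewrite mulr_sumr; apply: eq_bigr => j' _; rewrite ME normrM.
rewrite !ME normrM; apply/esym/phase_quotient_scale => //.
  by rewrite normr_eq0.
by rewrite gt_eqF// nrm1_gt0.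
Qed.

Lemma unit_lift_root i t A j : mnr A i != 0 -> t ^+ c_ i = 1 ->
  mnr (unit_lift i (wscale w t A)) j = t ^+ c_ j * mnr (unit_lift i A) j.
Proof.
move=> Ai t1; rewrite unit_lift_wscale ?(root_neq0 t1)//.
rewrite t1 mul1r mnr_scal ?unit_lift_factor// [RHS]mulrCA; congr (_ / _ * _).
apply: eq_bigr => j' _.
by rewrite normrM normrX (root_norm t1) expr1n mul1r.
Qed.

(** The modulus [r] of [t] brings the weighted norm to 1 by the intermediate value theorem; its
    phase [th] makes the i-th minor positive. *)
Lemma unit_lift_surj i A : mnr A i != 0 -> exists2 t, t != 0 &
  related t A (unit_lift i (wscale w t A)).
Proof.
move=> Ai; pose p : {poly R} := \sum_j (rmod (mnr A j))%:P * 'X^(c_ j) - 1.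
have pE (r : R) : p.[r] = \sum_j rmod (mnr A j) * r ^+ c_ j - 1.
  rewrite /p !hornerE horner_sum; congr (_ - _); apply: eq_bigr => j _.
  by rewrite !hornerE.
pose e := rmod (mnr A i); have e0 : 0 < e.
  by rewrite lt_def rmod_ge0 rmod_eq0 Ai.
have p0 : p.[0] <= 0.
  rewrite pE big1 ?sub0r ?lerN10// => j _.
  by rewrite expr0n (gtn_eqF (c_gt0 j)) mulr0.
(* At [1 + e^-1] the i-th term alone is at least [e * (1 + e^-1) = e + 1]. *)
have b1 : 1 <= 1 + e^-1 by rewrite lerDl invr_ge0 ltW.
have pb : 0 <= p.[1 + e^-1].
  rewrite pE subr_ge0 (bigD1 i)//= -/e; apply: ler_wpDr.
    apply: sumr_ge0 => j _; rewrite mulr_ge0 ?rmod_ge0// exprn_ge0//.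
    exact: le_trans b1.
  apply: (@le_trans _ _ (e * (1 + e^-1))).
    by rewrite mulrDr mulr1 mulfV ?gt_eqF// lerDr ltW.
  by apply: ler_wpM2l; [exact: ltW|rewrite ler_eXnr ?c_gt0].
have [r r01 /rootP] := poly_ivt (le_trans ler01 b1) (introT andP (conj p0 pb)).
rewrite pE => /eqP; rewrite subr_eq0 => /eqP r1.
have r_ge0 : 0 <= r by case/andP: r01.
have r0 : r != 0.
  apply/eqP => r0; have := oner_neq0 R; rewrite -r1 big1 ?eqxx// => j _.
  by rewrite r0 expr0n (gtn_eqF (c_gt0 j)) mulr0.
pose th := (c_ i).-root (`|mnr A i| / mnr A i).
have thE : th ^+ c_ i = `|mnr A i| / mnr A i by rewrite rootCK ?c_gt0.
have th1 : `|th| = 1.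
  apply: (@pexpIrn _ (c_ i)); rewrite ?c_gt0 ?nnegrE//.
  by rewrite -normrX thE normrM normfV normr_id divff ?normr_eq0// expr1n.
pose t : C := (r%:C)%C * th.
have tn : `|t| = (r%:C)%C.
  by rewrite normrM th1 mulr1 -rmodE rmod_real ger0_norm.
have t0 : t != 0 by rewrite -normr_eq0 tn (inj_eq (@complexI _) r 0).
exists t => // j; rewrite unit_lift_wscale//.
have -> : \sum_j' `|t ^+ c_ j' * mnr A j'| = 1.
  rewrite -[RHS](rmorph1 (real_complex R)) -r1 rmorph_sum; apply: eq_bigr => j' _.
  by rewrite normrM normrX tn -rmodE rmorphM rmorphXn mulrC.
have tiE : t ^+ c_ i * mnr A i = (r%:C)%C ^+ c_ i * `|mnr A i|.
  by rewrite exprMn thE -mulrA divfK.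
rewrite ger0_norm; last first.
  by rewrite tiE mulr_ge0 ?normr_ge0// exprn_ge0// (lecR 0).
by rewrite divff ?divr1 ?mul1r// mulf_neq0// expf_neq0.
Qed.

End WeightedOrbits.

(** * Cells of a quotient by the weighted action *)

Lemma prim_root_exists (K : numClosedFieldType) (e : nat) :
  (0 < e)%N -> exists z : K, e.-primitive_root z.
Proof.
move=> e_gt0; pose p : {poly K} := 'X^e - 1.
have [r Dp] := closed_field_poly_normal p.
rewrite (monicP _) ?monicXnsubC // scale1r in Dp.
have rn1 : all e.-unity_root r by apply/allP => z; rewrite -root_prod_XsubC -Dp.
have sz_r : (e < (size r).+1)%N.
  by rewrite -(size_prod_XsubC r id) -Dp size_XnsubC.
have [|z] := hasP (has_prim_root e_gt0 rn1 _ sz_r); last by exists z.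
by rewrite -separable_prod_XsubC -Dp separable_Xn_sub_1 // pnatr_eq0 -lt0n.
Qed.

Section Cells.
Variables (R : realType) (n d : nat) (d_gt0 : (0 < d)%N).
Variables (w : 'I_n -> nat) (a : nat) (a_gt0 : (0 < a)%N).
Variables (m : nat) (lam : 'I_m.+1 -> schubert n d).
Hypotheses (lam_bij : bijective lam).
Hypothesis lam_mono : forall i j, schubert_le (lam i) (lam j) -> (i <= j)%N.
Variable k : 'I_m.+1.
Local Notation C := (Cplx R).
Local Notation FR := (full_rank R n d).
Local Notation c_ i := (cnum lam w a i).
Local Notation mnr := (mnr lam).
Local Notation nrm1 := (nrm1 lam).
Local Notation related := (related w a lam).
Local Notation cellset := (cellset lam).
Local Notation scal := (scal d_gt0).
Local Notation unit_lift := (unit_lift d_gt0 lam).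
Local Notation XT := (@Xtilde R n d m lam k).
Implicit Types (A B : FR) (i j : 'I_m.+1) (t : C).

Variables (X : topologicalType) (p : XT -> X) (A0 : XT).
Hypotheses (hX : hausdorff_space X) (p_cont : continuous p).
Hypothesis p_surj : forall x, exists A : XT, p A = x.
Hypothesis p_eq : forall A B : XT, p A = p B <->
  exists2 t, t != 0 & related t (val A) (val B).

(** [X] stands for either quotient. The default [A0] outside [XT] lets [p] be applied to bare
    matrices. *)
Definition pX A : X := p (insubd A0 A).

Lemma pX_eq A B : XT A -> XT B ->
  pX A = pX B <-> exists2 t, t != 0 & related t A B.
Proof. by move=> /mem_set XA /mem_set XB; rewrite p_eq !insubdK. Qed.

Lemma pX_surj x : exists2 A, XT A & pX A = x.
Proof.
have [A <-] := p_surj x; exists (val A); first exact: (@set_valP _ XT A).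
by congr p; apply: val_inj; rewrite insubdK//; exact: valP.
Qed.

Lemma pX_cont (T : topologicalType) (g : T -> FR) :
  (forall x, XT (g x)) -> continuous g -> continuous (fun x => pX (g x)).
Proof.
move=> gX cg; have ci : continuous (fun x => insubd A0 (g x) : XT).
  apply: continuous_to_set; under eq_fun do rewrite insubdK ?mem_set//.
  exact: cg.
exact: (cont_comp ci p_cont).
Qed.

Lemma cellset_XT i A : (i <= k)%N -> cellset i A -> XT A.
Proof. by move=> ik [_ Aj] j kj; apply: Aj; exact: leq_ltn_trans kj. Qed.

Definition Cell i : set X := [set x | exists2 A, cellset i A & pX A = x].

Definition Stage (e : nat) : set X :=
  [set x | exists A, [/\ XT A, forall j, (e < j)%N -> mnr A j = 0 & pX A = x]].

Lemma Cell_pX i A : (i <= k)%N -> XT A -> Cell i (pX A) -> cellset i A.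
Proof.
move=> ik XA [B Bi BX]; have [t t0 BA] := (pX_eq (cellset_XT ik Bi) XA).1 BX.
exact: related_cellset t0 BA Bi.
Qed.

(** * The characteristic map of one cell *)

Section OneCell.
Variables (i : 'I_m.+1) (ik : (i <= k)%N).
Variables (l : nat) (Phi : ('I_l -> C) -> 'M[C]_(n, d)).
Hypothesis BS : bott_samelson (entry (lam i)) Phi.

Definition chart (v : @disk R (l + l)) : 'I_l -> C := to_polydisk (cplx (val v)).

Lemma diskP (v : @disk R (l + l)) : sqnorm (val v) <= 1.
Proof. exact: (@set_valP _ (@disk R (l + l)) v). Qed.

Lemma vmax_chart v : vmax (chart v) = Num.sqrt (sqnorm (val v)).
Proof. by rewrite vmax_to_polydisk vnorm_cplx. Qed.

Lemma chart_le1 v q : `|chart v q| <= 1.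
Proof.
rewrite rmod_le1; apply: le_trans (rmod_le_vmax _ _) _.
by rewrite vmax_chart -sqrtr1 ler_sqrt ?diskP.
Qed.

Lemma chart_lt1 v : sqnorm (val v) <> 1 <-> forall q, `|chart v q| < 1.
Proof.
have -> : (forall q, `|chart v q| < 1) <-> vmax (chart v) < 1.
  split=> [v1|v1 q]; last by rewrite rmod_lt1; exact: le_lt_trans (rmod_le_vmax _ _) v1.
  by apply/bigmax_ltP; split=> // q _; rewrite -rmod_lt1.
rewrite vmax_chart -[X in _ < X]sqrtr1 ltr_sqrt// lt_neqAle diskP andbT.
by split=> [h|/eqP//]; exact/eqP.
Qed.

Definition cellmx v : FR := mkfr (bs_rank BS (chart_le1 v)).

Lemma mnr_cellmx v : mnr (cellmx v) i = \prod_q (1 - `|chart v q|).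
Proof. exact: (bs_minor BS (chart_le1 v)). Qed.

Lemma mnr_cellmx_neq0 v : mnr (cellmx v) i != 0 <-> sqnorm (val v) <> 1.
Proof. by rewrite chart_lt1; exact: (bs_interior BS (chart_le1 v)). Qed.

Lemma mnr_cellmx_gt0 v : mnr (cellmx v) i != 0 -> 0 < mnr (cellmx v) i.
Proof.
move=> v0; rewrite lt_def v0 mnr_cellmx/= prodr_ge0// => q _.
by rewrite subr_ge0 chart_le1.
Qed.

Lemma cellmx_supp v j : (i < j)%N -> mnr (cellmx v) j = 0.
Proof.
move=> ij; apply/eqP; apply: contraLR ij.
by move=> /(bs_supp BS (chart_le1 v))/cle_entryP/lam_mono; rewrite -leqNgt.
Qed.

Lemma cellmx_cellset v : sqnorm (val v) <> 1 -> cellset i (cellmx v).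
Proof. by move=> /mnr_cellmx_neq0 v1; split=> //; exact: cellmx_supp. Qed.

Lemma cont_cellmx r s : continuous (fun v => val (cellmx v) r s).
Proof.
apply: (bs_continuous BS) => q.
exact: (cont_comp (@continuous_val _ _) (@continuous_polydisk R l q)).
Qed.

Lemma nrm1V_neq0 A : (nrm1 A)^-1 != 0.
Proof. by rewrite invr_eq0 gt_eqF// nrm1_gt0. Qed.

(** Norm 1 forces a scalar relating two such matrices to have modulus 1, leaving only roots of unity
    over the interior. *)
Definition chartmx v : FR := scal (nrm1 (cellmx v))^-1 (cellmx v).

Lemma mnr_chartmx v j : mnr (chartmx v) j = (nrm1 (cellmx v))^-1 * mnr (cellmx v) j.
Proof. by rewrite mnr_scal// nrm1V_neq0. Qed.

Lemma nrm1_chartmx v : nrm1 (chartmx v) = 1.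
Proof.
rewrite nrm1_scal ?nrm1V_neq0// ger0_norm ?invr_ge0 ?ltW ?nrm1_gt0//.
by rewrite mulVf// gt_eqF// nrm1_gt0.
Qed.

Lemma chartmx_supp v j : (i < j)%N -> mnr (chartmx v) j = 0.
Proof. by move=> ij; rewrite mnr_chartmx cellmx_supp// mulr0. Qed.

Lemma chartmx_XT v : XT (chartmx v).
Proof. by move=> j kj; apply: chartmx_supp; exact: leq_ltn_trans kj. Qed.

Lemma mnr_chartmx_gt0 v : sqnorm (val v) <> 1 -> 0 < mnr (chartmx v) i.
Proof.
move=> /mnr_cellmx_neq0/mnr_cellmx_gt0 v0.
by rewrite mnr_chartmx mulr_gt0// invr_gt0 nrm1_gt0.
Qed.

Lemma chartmx_cellset v : sqnorm (val v) <> 1 <-> cellset i (chartmx v).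
Proof.
rewrite scal_cellset ?nrm1V_neq0//; split; first exact: cellmx_cellset.
by move=> [/mnr_cellmx_neq0].
Qed.

Definition attaching (v : @disk R (l + l)) : X := pX (chartmx v).

Lemma cont_attaching : continuous attaching.
Proof.
apply: pX_cont; first exact: chartmx_XT.
apply: cont_scal; [by move=> v; exact: nrm1V_neq0| |exact: cont_cellmx].
apply: contV; first by move=> v; rewrite gt_eqF// nrm1_gt0.
exact/cont_nrm1/cont_cellmx.
Qed.

Lemma attaching_Cell v : sqnorm (val v) <> 1 <-> Cell i (attaching v).
Proof.
rewrite chartmx_cellset; split=> [vi|]; first by exists (chartmx v).
by apply: Cell_pX => //; exact: chartmx_XT.
Qed.

Lemma chartmxE v : mnr (cellmx v) i != 0 -> unit_lift i (cellmx v) = chartmx v.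
Proof.
move=> v0; have e1 : `|mnr (cellmx v) i| / mnr (cellmx v) i = 1.
  by rewrite gtr0_norm ?divff// mnr_cellmx_gt0.
by rewrite /chartmx /(unit_lift _ _) e1 mul1r.
Qed.

(** A change of basis multiplies all minors by [\det T], which the normalization removes; the minors
    of the unit lift are thus functions on the Schubert cell. *)
Lemma unit_lift_pi A B j : cellset i A -> \pi_(Gr R n d) A = \pi_(Gr R n d) B ->
  mnr (unit_lift i A) j = mnr (unit_lift i B) j.
Proof.
move=> [Ai _] /pi_GrP[T uT BE]; have dT : \det T != 0 by rewrite -unitfE -unitmxE.
have Bm j' : mnr B j' = \det T * mnr A j' by rewrite (mnr_mulr lam _ BE) mulrC.
have Bi : mnr B i != 0 by rewrite Bm; exact: mulf_neq0.
have fA := unit_lift_factor lam_bij Ai; have fB := unit_lift_factor lam_bij Bi.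
have -> : mnr (unit_lift i A) j = `|mnr A i| / mnr A i / nrm1 A * mnr A j.
  exact: mnr_scal fA.
have -> : mnr (unit_lift i B) j = `|mnr B i| / mnr B i / nrm1 B * mnr B j.
  exact: mnr_scal fB.
have -> : nrm1 B = `|\det T| * nrm1 A.
  by rewrite mulr_sumr; apply: eq_bigr => j' _; rewrite Bm normrM.
rewrite !Bm normrM; apply/esym/phase_quotient_scale => //.
  by rewrite normr_eq0.
by rewrite gt_eqF// nrm1_gt0.
Qed.

Lemma unit_lift_cellset A : cellset i A -> cellset i (unit_lift i A).
Proof. by move=> Ai; apply/scal_cellset => //; exact: (unit_lift_factor lam_bij Ai.1). Qed.

Lemma chart_surj A : cellset i A -> exists2 v, sqnorm (val v) <> 1 &
  \pi_(Gr R n d) (cellmx v) = \pi_(Gr R n d) A.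
Proof.
move=> /(cellsetP lam_bij lam_mono)/(bs_surj BS)[u [T [u1 uT AE]]].
have [x xu] := cplx_surj (of_polydisk u).
have xE : to_polydisk (cplx x) = u.
  by apply/funext => q; rewrite (funext xu) of_polydiskK.
have x1 : sqnorm x < 1.
  have : vmax u < 1 by apply/bigmax_ltP; split=> // q _; rewrite -rmod_lt1.
  by rewrite -xE vmax_to_polydisk vnorm_cplx -[X in _ < X]sqrtr1 ltr_sqrt.
pose v : @disk R (l + l) := exist (fun x => x \in @disk R (l + l)) x (mem_set (ltW x1)).
exists v; first by apply/eqP; rewrite lt_eqF.
by apply/pi_GrP; exists T => //; rewrite AE /= -xE.
Qed.

Lemma attaching_surj A : cellset i A -> exists v, attaching v = pX A.
Proof.
move=> Ai; have [t t0 At] := unit_lift_surj d_gt0 w a_gt0 lam_bij Ai.1.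
have Bi : cellset i (wscale w t A).
  split=> [|j /Ai.2 Aj]; rewrite mnr_wscale//; last by rewrite Aj mulr0.
  by apply: mulf_neq0; [exact: expf_neq0|exact: Ai.1].
have [v v1 vB] := chart_surj Bi; exists v; apply/esym/pX_eq.
- exact: cellset_XT Ai.
- exact: chartmx_XT.
exists t => // j; rewrite -At -chartmxE; last exact/mnr_cellmx_neq0.
by apply: unit_lift_pi => //; exact: cellmx_cellset.
Qed.

Lemma StageS (e : nat) : i = e.+1 :> nat -> Stage e.+1 = Stage e `|` range attaching.
Proof.
move=> ie; apply/seteqP; split=> [_ [A [XA Aj <-]]|x [[A [XA Aj <-]]|[v _ <-]]].
- have [Ai|Ai] := eqVneq (mnr A i) 0; last first.
    right; have [|v vA] := @attaching_surj A; last by exists v.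
    by split=> // j; rewrite ie; exact: Aj.
  left; exists A; split=> // j; rewrite leq_eqVlt => /orP[/eqP ej|]; last exact: Aj.
  by rewrite (_ : j = i)//; apply: val_inj; rewrite /= ie ej.
- by exists A; split=> // j ej; apply: Aj; exact: ltnW.
- exists (chartmx v); split=> // [|j ej]; first exact: chartmx_XT.
  by apply: chartmx_supp; rewrite ie.
Qed.


Lemma compact_Stage (e : nat) : i = e.+1 :> nat -> compact (Stage e) ->
  compact (Stage e.+1).
Proof.
move=> ie cS; rewrite (StageS ie).
apply: compactU => //; apply: compact_image; first exact: cont_attaching.
exact/compact_set_type/compact_disk.
Qed.

(** * Roots of unity acting on the disk *)

Section Phases.
Variables (c0 : nat) (zeta : C) (chi : 'I_l -> C).
Hypotheses (c0E : c0.+1 = c_ i) (zeta_prim : c0.+1.-primitive_root zeta).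
Hypotheses (chi1 : forall q, `|chi q| = 1) (chic : forall q, chi q ^+ c0.+1 = 1).
Hypothesis chi_equiv : forall (g : nat) (v : 'I_l -> C), (forall q, `|v q| <= 1) ->
  exists2 T, \det T = (zeta ^+ g) ^+ sig w lam i &
    wdiag w (zeta ^+ g) *m Phi v = Phi (fun q => chi q ^+ g * v q) *m T.

Let rG := phase_representation chic.

Lemma phases_stable : disk_stable rG.
Proof.
move=> g v _ v1; rewrite /disk/= sqnorm_phase// => q.
by rewrite normrX chi1 expr1n.
Qed.

Lemma chart_phase (x : 'rV[R]_(l + l)) (g : 'I_c0.+1) q :
  to_polydisk (cplx (x *m rG g)) q = chi q ^+ g * to_polydisk (cplx x) q.
Proof.
rewrite -(to_polydisk_phase (chi := fun q => chi q ^+ g)); last first.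
  by move=> r; rewrite normrX chi1 expr1n.
congr (to_polydisk _ q); apply/funext => r; exact: cplx_phase.
Qed.

Lemma zeta_root (g : nat) : (zeta ^+ g) ^+ c_ i = 1.
Proof. by rewrite -exprM mulnC exprM -c0E (prim_expr_order zeta_prim) expr1n. Qed.

Lemma chartmx_phase u v (g : 'I_c0.+1) j : val v = val u *m rG g ->
  mnr (chartmx v) j = (zeta ^+ g) ^+ c_ j * mnr (chartmx u) j.
Proof.
move=> vE; have [T dT TE] := chi_equiv g (chart_le1 u).
set t := zeta ^+ g in dT TE *; have ti : t ^+ c_ i = 1 by exact: zeta_root.
have t0 := root_neq0 a_gt0 ti; have t1 := root_norm a_gt0 ti.
have cv : chart v = fun q => chi q ^+ g * chart u q.
  by apply/funext => q; rewrite /chart vE chart_phase.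
have uv : val (wscale w t (cellmx u)) = val (cellmx v) *m T.
  by rewrite val_wscale//= cv.
(* Equivariance gives the factor [t ^+ sig j'] against [\det T = t ^+ sig i]. Since
   [c_j' - c_i = sig j' - sig i], the relation [t ^+ c_i = 1] leaves [t ^+ c_j']. *)
have mE j' : mnr (cellmx v) j' = t ^+ c_ j' * mnr (cellmx u) j'.
  have := mnr_mulr lam j' uv; rewrite mnr_wscale// dT => mE.
  apply: (mulIf (expf_neq0 (sig w lam i) t0)); rewrite -mE -[LHS]mul1r -ti.
  by rewrite /cnum !exprD; ring.
have nE : nrm1 (cellmx v) = nrm1 (cellmx u).
  by apply: eq_bigr => j' _; rewrite mE normrM normrX t1 expr1n mul1r.
by rewrite !mnr_chartmx mE nE; exact: mulrCA.
Qed.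

Lemma attaching_orbit u v : disk_orbit rG u v -> attaching u = attaching v.
Proof.
move=> /asboolP[g _ vE]; apply/pX_eq; [exact: chartmx_XT|exact: chartmx_XT|].
exists (zeta ^+ (g : 'I_c0.+1)); first exact: (root_neq0 a_gt0 (zeta_root _)).
by move=> j; exact: chartmx_phase.
Qed.

(** Norm 1 and positive i-th minors make [t] a power of [zeta]. The column spaces then differ by the
    action of [t], and injectivity of the chart recovers the phases. *)
Lemma attaching_inj u v : sqnorm (val u) <> 1 -> attaching u = attaching v ->
  disk_orbit rG u v.
Proof.
move=> u1 /(pX_eq (chartmx_XT u) (chartmx_XT v))[t t0 uv].
have v1 : sqnorm (val v) <> 1.
  by apply/chartmx_cellset; apply: related_cellset t0 uv _; exact/chartmx_cellset.
have ti : t ^+ c_ i = 1.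
  apply: (related_root a_gt0 lam_bij uv); last exact: mnr_chartmx_gt0.
    by rewrite !nrm1_chartmx.
  exact: mnr_chartmx_gt0.
have [g tE] : {g : 'I_c0.+1 | t = zeta ^+ g}.
  by apply: (prim_rootP zeta_prim); rewrite c0E.
have [T dT TE] := chi_equiv g (chart_le1 u); rewrite -tE in dT TE.
have := @root_act _ _ _ w a a_gt0 m lam lam_bij t (cellmx u) (cellmx v) i
  (nrm1 (cellmx v) / nrm1 (cellmx u)).
have nu0 : nrm1 (cellmx u) != 0 by rewrite gt_eqF// nrm1_gt0.
have nv0 : nrm1 (cellmx v) != 0 by rewrite gt_eqF// nrm1_gt0.
case/(_ _ _ ti _)/esym/pi_GrP => //.
- exact/mnr_cellmx_neq0.
- exact: (mulf_neq0 nv0 (nrm1V_neq0 _)).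
- move=> j; have := uv j; rewrite !mnr_chartmx => /(canRL (mulVKf nv0)) ->.
  by rewrite -mulrA; congr (_ * _); rewrite mulrCA.
move=> T' uT' vE; have uT : T \in unitmx.
  by rewrite unitmxE unitfE dT; exact: expf_neq0.
have cv : chart v =1 fun q => chi q ^+ g * chart u q.
  apply: (bs_inj BS _ _ (_ : T *m T' \in unitmx)).
  - exact/chart_lt1.
  - by move=> q; rewrite normrM normrX chi1 expr1n mul1r; exact: (chart_lt1 u).1.
  - by rewrite unitmx_mul uT.
  - by move: vE; rewrite val_wscale//= TE mulmxA.
apply/asboolP; exists g; first by rewrite inE.
apply: cplx_inj => q; rewrite -to_polydiskK -[RHS]to_polydiskK.
congr (of_polydisk _ q); apply/funext => r.
by rewrite chart_phase; exact: cv.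
Qed.

Lemma Stage_attach (e : nat) : i = e.+1 :> nat -> compact (Stage e) ->
  attach_qcell R (Stage e) (Stage e.+1).
Proof.
move=> ie cS; apply: (@attach_qcellI R (l + l) _ _ rG X (Stage e) (Stage e.+1) attaching).
- exact: hX.
- exact: phases_stable.
- exact: cont_attaching.
- exact: cS.
- exact: attaching_orbit.
- move=> v v1; exists (chartmx v); split=> // [|j ej]; first exact: chartmx_XT.
  have [ij|ij] := ltnP i j; first exact: chartmx_supp.
  have -> : j = i by apply/val_inj/anti_leq; rewrite ij /= ie ej.
  rewrite mnr_chartmx (_ : mnr _ i = 0) ?mulr0//; apply/eqP/negPn/negP.
  by move=> /mnr_cellmx_neq0.
- move=> v v1 [A [XA Aj Av]]; have [Ai _] : cellset i A.
    by apply: Cell_pX => //; rewrite Av; exact/attaching_Cell.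
  by case/eqP: Ai; apply: Aj; rewrite ie.
- exact: attaching_inj.
exact: StageS.
Qed.

End Phases.

(** * Comparison with the orbit space of the Schubert cell *)

Section QuotientCell.
Variables (r : nat) (r_dvd : (r %| c_ i)%N).
Local Notation cell := (@schubert_cell R n d (lam i)).
Local Notation QC := (qcell R w (c_ i) r (lam i)).

Lemma repr_cellset (x : cell) : cellset i (repr (val x)).
Proof.
apply/(cellsetP lam_bij lam_mono)/schubert_cellP; rewrite reprK.
exact: (@set_valP _ cell x).
Qed.

Definition kappa0 (x : cell) : X := pX (unit_lift i (repr (val x))).

Lemma unit_lift_XT A : cellset i A -> XT (unit_lift i A).
Proof. by move=> /unit_lift_cellset; exact: cellset_XT. Qed.

Lemma kappa0_pi (x : cell) A : \pi_(Gr R n d) A = val x -> kappa0 x = pX (unit_lift i A).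
Proof.
move=> Ax; have Xi := repr_cellset x.
have E : \pi_(Gr R n d) (repr (val x)) = \pi_(Gr R n d) A by rewrite reprK.
have Ai : cellset i A.
  apply/(cellsetP lam_bij lam_mono)/schubert_cellP; rewrite Ax.
  exact: (@set_valP _ cell x).
apply/pX_eq; [exact: unit_lift_XT|exact: unit_lift_XT|exists 1; first exact: oner_neq0].
by move=> j; rewrite expr1n mul1r; apply/esym/unit_lift_pi.
Qed.

(** A quotient map restricted to a subspace need not be a quotient map; here it is open and the
    matrices over the cell form a saturated set, so open sets descend. *)
Lemma cont_kappa0 : continuous kappa0.
Proof.
pose S : set FR := cellset i; pose nu (A : S) : X := pX (unit_lift i (val A)).
have Si (A : S) : cellset i (val A) by exact: (@set_valP _ S A).
have cnu : continuous nu.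
  apply: pX_cont; first by move=> A; exact: unit_lift_XT.
  have cv a' b : continuous (fun A : S => val (val A) a' b).
    by apply: cont_entry; exact: (cont_comp (@continuous_val _ S) (@continuous_val _ _)).
  have cm : continuous (fun A : S => mnr (val A) i) by apply: cont_mnr; exact: cv.
  have cn : continuous (fun A : S => nrm1 (val A)) by apply: cont_nrm1; exact: cv.
  have n0 (A : S) : nrm1 (val A) != 0 by rewrite gt_eqF// nrm1_gt0.
  apply: cont_scal; [by move=> A; exact: (unit_lift_factor lam_bij (Si A).1)| |exact: cv].
  have i0 (A : S) : mnr (val A) i != 0 by exact: (Si A).1.
  exact: (contM (contM (cont_norm cm) (contV i0 cm)) (contV n0 cn)).
apply/continuousP => U oU; move/continuousP: cnu => /(_ U oU)[W oW WU].
exists (\pi_(Gr R n d) @` W); first exact: pi_Gr_open.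
have memW (A : FR) (Ai : S A) : W A <-> U (pX (unit_lift i A)).
  have /seteqP[s1 s2] := WU.
  by split; [exact: (s1 (exist _ A (mem_set Ai)))|exact: (s2 (exist _ A (mem_set Ai)))].
apply/seteqP; split=> [x [A WA Ax]|x Ux].
  rewrite /preimage/= (kappa0_pi Ax); apply/memW => //.
  apply/(cellsetP lam_bij lam_mono)/schubert_cellP; rewrite Ax.
  exact: (@set_valP _ cell x).
exists (repr (val x)); last exact: reprK.
by apply/memW => //; exact: repr_cellset.
Qed.

Lemma kappa0_orbit (x y : cell) : cell_orbit w (c_ i) r x y -> kappa0 x = kappa0 y.
Proof.
move=> /asboolP[s [t [_ t0 t1 _ yE]]].
rewrite (@kappa0_pi y (wscale w t (repr (val x)))); last by rewrite yE.
have Xi := repr_cellset x.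
have Yi : cellset i (wscale w t (repr (val x))).
  apply/(cellsetP lam_bij lam_mono)/schubert_cellP.
  by have := @set_valP _ cell y; rewrite yE.
apply/pX_eq; [exact: unit_lift_XT|exact: unit_lift_XT|exists t => // j].
exact: (unit_lift_root _ _ _ _ Xi.1).
Qed.

Definition kappa : QC -> X := kappa0 \o repr.

Lemma kappa_pi (x : cell) : kappa (\pi_QC x) = kappa0 x.
Proof. by apply: kappa0_orbit; apply/eqmodP; rewrite reprK. Qed.

Lemma cont_kappa : continuous kappa.
Proof.
apply: repr_comp_continuous; first exact: cont_kappa0.
by move=> x y /eqP xy; apply/eqP/kappa0_orbit; exact/eqmodP.
Qed.

Lemma kappa_inj : injective kappa.
Proof.
move=> q q'; rewrite /kappa/= -{2}[q]reprK -{2}[q']reprK.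
move: (repr q) (repr q') => x y {q q'}; set A := repr (val x); set B := repr (val y).
have Xi : cellset i A := repr_cellset x; have Yi : cellset i B := repr_cellset y.
case/(pX_eq (unit_lift_XT Xi) (unit_lift_XT Yi)) => t t0 AB.
have t1 : t ^+ c_ i = 1.
  apply: (related_root a_gt0 lam_bij AB).
  - by rewrite (nrm1_unit_lift d_gt0 lam_bij Xi.1) (nrm1_unit_lift d_gt0 lam_bij Yi.1).
  - exact: (unit_lift_gt0 _ _ Xi.1).
  - exact: (unit_lift_gt0 _ _ Yi.1).
have [kA kA0 EA] := unit_lift_mnr d_gt0 lam_bij Xi.1.
have [kB kB0 EB] := unit_lift_mnr d_gt0 lam_bij Yi.1.
apply/eqmodP/asboolP; exists (t ^+ r), t; split=> //.
  by rewrite -exprM mulnC divnK.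
rewrite -[val y]reprK /gr_act.
have k0 : kB^-1 * kA != 0 by apply: mulf_neq0 => //; rewrite invr_eq0.
apply: (root_act a_gt0 lam_bij Xi.1 k0 t1) => j.
by apply: scale_ratio kB0 _; rewrite -EA -EB; exact: AB.
Qed.

Lemma kappa_range : range kappa = Cell i.
Proof.
apply/seteqP; split=> [_ [q _ <-]|_ [A Ai <-]].
  exists (unit_lift i (repr (val (repr q)))) => //.
  exact/unit_lift_cellset/repr_cellset.
have [t t0 At] := unit_lift_surj d_gt0 w a_gt0 lam_bij Ai.1.
have Bi : cellset i (wscale w t A).
  split=> [|j /Ai.2 Aj]; rewrite mnr_wscale//; last by rewrite Aj mulr0.
  by apply: mulf_neq0; [exact: expf_neq0|exact: Ai.1].
have Bc : \pi_(Gr R n d) (wscale w t A) \in cell.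
  by apply/mem_set/schubert_cellP/(cellsetP lam_bij lam_mono).
pose y : cell := exist (fun x => x \in cell) _ Bc.
exists (\pi_QC y); first by [].
apply: (etrans (kappa_pi y)); apply: (etrans (@kappa0_pi y (wscale w t A) erefl)).
apply/esym/pX_eq; [exact: cellset_XT Ai|exact: unit_lift_XT|by exists t].
Qed.

Lemma Cell_homeomorphic : homeomorphic QC (Cell i).
Proof.
have intv (v : attaching @^-1` Cell i) : sqnorm (val (val v)) <> 1.
  by apply/attaching_Cell; exact: (@set_valP _ (attaching @^-1` Cell i) v).
have cellv (v : attaching @^-1` Cell i) : \pi_(Gr R n d) (cellmx (val v)) \in cell.
  by apply/mem_set/schubert_cellP/(cellsetP lam_bij lam_mono)/cellmx_cellset.
pose e0 v : cell := exist (fun x => x \in cell) _ (cellv v).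
apply: (@cell_homeomorphic _ X QC attaching (Cell i) kappa (fun v => \pi_QC (e0 v))).
- exact/compact_set_type/compact_disk.
- exact: hX.
- exact: cont_attaching.
- exact: cont_kappa.
- exact: kappa_inj.
- exact: kappa_range.
- have cmx : continuous (fun v : attaching @^-1` Cell i => cellmx (val v)).
    apply: continuous_to_set; apply: cont_mx => b s.
    exact: (cont_comp (@continuous_val _ (attaching @^-1` Cell i)) (@cont_cellmx b s)).
  have ce0 : continuous e0.
    by apply: continuous_to_set; exact: (cont_comp cmx (@pi_continuous _ _)).
  exact: (cont_comp ce0 (@pi_continuous _ _)).
- move=> q; have [v v1 vq] := chart_surj (repr_cellset (repr q)).
  have vC : v \in attaching @^-1` Cell i by apply/mem_set/attaching_Cell.
  exists (exist (fun v => v \in attaching @^-1` Cell i) v vC).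
  rewrite -[RHS]reprK; congr (\pi_QC _); apply: val_inj.
  by rewrite /= vq reprK.
- move=> v; apply: (etrans (kappa_pi (e0 v))).
  apply: (etrans (@kappa0_pi (e0 v) (cellmx (val v)) erefl)).
  by rewrite chartmxE; last exact/mnr_cellmx_neq0.
Qed.

End QuotientCell.
Lemma phases_exist : exists (zeta : C) (chi : 'I_l -> C),
  [/\ (c_ i).-1.+1.-primitive_root zeta, forall q, `|chi q| = 1,
      forall q, chi q ^+ (c_ i).-1.+1 = 1 &
      forall (g : nat) (v : 'I_l -> C), (forall q, `|v q| <= 1) ->
      exists2 T, \det T = (zeta ^+ g) ^+ sig w lam i &
        wdiag w (zeta ^+ g) *m Phi v = Phi (fun q => chi q ^+ g * v q) *m T].
Proof.
have [zeta zP] := prim_root_exists C (ltn0Sn (c_ i).-1).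
have cE : (c_ i).-1.+1 = c_ i by rewrite prednK// c_gt0.
have z1 : zeta ^+ c_ i = 1 by rewrite -cE; exact: (prim_expr_order zP).
have nz := root_norm a_gt0 z1; have z0 := root_neq0 a_gt0 z1.
have u1 b : `|zeta ^+ w b| = 1 by rewrite normrX nz expr1n.
have [chi [chi1 chiP]] := bs_equiv BS u1.
have iter (g : nat) (v : 'I_l -> C) : (forall q, `|v q| <= 1) ->
    exists2 T, \det T = (zeta ^+ g) ^+ sig w lam i &
      wdiag w (zeta ^+ g) *m Phi v = Phi (fun q => chi q ^+ g * v q) *m T.
  move=> v1; elim: g => [|g [T dT TE]].
    exists 1%:M; first by rewrite det1 expr0 expr1n.
    rewrite expr0 wdiag1 mul1mx mulmx1; congr Phi.
    by apply/funext => q; rewrite expr0 mul1r.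
  have vg q : `|chi q ^+ g * v q| <= 1 by rewrite normrM normrX chi1 expr1n mul1r.
  have [T' dT' TE'] := chiP _ vg; exists (T' *m T).
    rewrite det_mulmx dT dT' exprS exprMn; congr (_ * _).
    rewrite (big_morph (fun e => zeta ^+ e) (exprD zeta) (expr0 zeta)).
    by [].
  rewrite exprS wdiagM -mulmxA TE mulmxA -[wdiag w zeta]/(diag_mx _) TE' -mulmxA.
  by congr (Phi _ *m _); apply/funext => q; rewrite exprS mulrA.
exists zeta, chi; split=> // q; rewrite cE.
(* At the interior point with all parameters 1/2, [zeta ^+ c_i = 1] acts trivially. Injectivity of
   the chart gives [chi ^+ c_i = 1], as 1/2 is nonzero. *)
have h1 : `|2^-1 : C| < 1 by rewrite ger0_norm ?invr_ge0// invf_lt1// ltr1n.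
have [T dT TE] := iter (c_ i) (fun=> 2^-1) (fun=> ltW h1).
have uT : T \in unitmx by rewrite unitmxE unitfE dT z1 expr1n oner_neq0.
have h2 r : `|chi r ^+ c_ i * 2^-1| < 1 by rewrite normrM normrX chi1 expr1n mul1r.
have E : Phi (fun=> 2^-1) = Phi (fun r => chi r ^+ c_ i * 2^-1) *m T.
  by rewrite -TE z1 wdiag1 mul1mx.
have := bs_inj BS (fun=> h1) h2 uT E q => /esym E'.
by apply: (@mulIf _ 2^-1); rewrite ?invr_eq0 ?pnatr_eq0// mul1r.
Qed.

Lemma Stage_attach_qcell (e : nat) : i = e.+1 :> nat -> compact (Stage e) ->
  attach_qcell R (Stage e) (Stage e.+1).
Proof.
have [zeta [chi [zP chi1 chic chiE]]] := phases_exist.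
have c0E : (c_ i).-1.+1 = c_ i by rewrite prednK// c_gt0.
exact: (Stage_attach c0E zP chi1 chic chiE).
Qed.

Lemma Cell_nonempty : exists x, Cell i x.
Proof.
have d0 : (0 : 'rV[R]_(l + l)) \in @disk R (l + l).
  by apply/mem_set; rewrite /disk/= /sqnorm big1// => q _; rewrite mxE expr0n.
exists (attaching (exist (fun x => x \in @disk R (l + l)) 0 d0)).
apply/attaching_Cell; rewrite /= /sqnorm big1 => [/esym/eqP|q _].
  by rewrite oner_eq0.
by rewrite mxE expr0n.
Qed.


End OneCell.

(** * Assembling the cells into a filtration *)

Lemma Cell_eq i j : (i <= k)%N -> (j <= k)%N -> forall x, Cell i x -> Cell j x -> i = j.
Proof.
move=> ik jk _ [A Ai <-] /(Cell_pX jk (cellset_XT ik Ai)) Aj.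
apply/val_inj/anti_leq/andP; split; rewrite leqNgt; apply/negP => ij.
  by case/eqP: Ai.1; exact: Aj.2.
by case/eqP: Aj.1; exact: Ai.2.
Qed.

Lemma Stage_diff (e : nat) i : i = e.+1 :> nat -> (i <= k)%N ->
  Stage e.+1 `\` Stage e = Cell i.
Proof.
move=> ie ik; apply/seteqP; split=> [x [[A [XA Aj Ax]] nx]|_ [A Ai <-]].
  exists A => //; split=> [|j]; last by rewrite ie; exact: Aj.
  apply/eqP => Ai; apply: nx; exists A; split=> // j ej.
  have [ij|ji] := ltnP i j; first by apply: Aj; rewrite -ie.
  by rewrite (_ : j = i)//; apply/val_inj/anti_leq; rewrite ji /= ie.
have XA := cellset_XT ik Ai; split.
  by exists A; split=> // j; rewrite -ie; exact: Ai.2.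
move=> [B [XB Bj BA]]; have Bi : cellset i B.
  by apply: Cell_pX => //; rewrite BA; exists A.
by case/eqP: Bi.1; apply: Bj; rewrite ie.
Qed.

Lemma Stage0 : Stage 0 = Cell ord0.
Proof.
apply/seteqP; split=> [x [A [XA Aj Ax]]|_ [A A0' <-]]; last first.
  by exists A; split; [exact: cellset_XT A0'|exact: A0'.2|].
exists A => //; split=> //; apply/eqP => A0'.
have := nrm1_gt0 lam_bij A; rewrite /(nrm1 _) big1 ?ltxx// => j _.
have [->|j0] := eqVneq j ord0; first by rewrite A0' normr0.
by rewrite Aj ?normr0// lt0n.
Qed.

(** Only the minor of index 0 is nonzero, and a [c_0]-th root of the ratio relates the two
    matrices. *)
Lemma Stage0_uniq x y : Stage 0 x -> Stage 0 y -> x = y.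
Proof.
rewrite Stage0 => -[A Ai <-] [B Bi <-].
have k0 : (@ord0 m <= k)%N by exact: leq0n.
apply/pX_eq; [exact: (cellset_XT k0 Ai)|exact: (cellset_XT k0 Bi)|].
pose t := (c_ ord0).-root (mnr B ord0 / mnr A ord0).
have tE : t ^+ c_ ord0 = mnr B ord0 / mnr A ord0 by rewrite rootCK ?c_gt0.
exists t => [|j].
  have : t ^+ c_ ord0 != 0.
    by rewrite tE; apply: (mulf_neq0 Bi.1); rewrite invr_eq0; exact: Ai.1.
  by rewrite expf_eq0 c_gt0.
have [->|j0] := eqVneq j ord0; first by rewrite tE divfK//; exact: Ai.1.
by rewrite Ai.2 ?Bi.2 ?mulr0// lt0n.
Qed.

Lemma Stage_top : Stage k = setT.
Proof. by apply/seteqP; split=> // x _; have [A XA <-] := pX_surj x; exists A. Qed.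

Lemma Stage_compact (e : nat) : (e <= k)%N -> compact (Stage e).
Proof.
elim: e => [_|e IHe ek].
  have [l [Phi BS]] := bott_samelson_exists R (@entry_inj _ _ (lam ord0)).
  have [x Cx] := Cell_nonempty (i := ord0) (leq0n k) BS.
  have -> : Stage 0 = [set x]; last exact: compact_set1.
  apply/seteqP; split=> [y Sy|_ ->]; last by rewrite Stage0.
  by apply: (Stage0_uniq Sy); rewrite Stage0.
have em : (e.+1 < m.+1)%N by exact: leq_ltn_trans ek _.
have [l [Phi BS]] := bott_samelson_exists R (@entry_inj _ _ (lam (Ordinal em))).
exact: (compact_Stage (i := Ordinal em) ek BS erefl (IHe (ltnW ek))).
Qed.

Lemma qcell_structure_Stage : @qcell_structure R X k Stage.
Proof.
split=> [U|e ek|]; last exact: Stage_top.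
- have [[x Ux]|nU] := pselect (exists x, U x).
    rewrite (_ : U = setT); first exact: openT.
    apply/seteqP; split=> // y _; rewrite (_ : y = x)//; apply: val_inj.
    by apply: Stage0_uniq; exact: (@set_valP _ (Stage 0) _).
  rewrite (_ : U = set0); first exact: open0.
  by apply/seteqP; split=> // x Ux; apply: nU; exists x.
have em : (e.+1 < m.+1)%N by exact: leq_ltn_trans ek _.
have [l [Phi BS]] := bott_samelson_exists R (@entry_inj _ _ (lam (Ordinal em))).
exact: (Stage_attach_qcell (i := Ordinal em) ek BS erefl (Stage_compact (ltnW ek))).
Qed.

Lemma inject_le (i : 'I_k.+1) : (inject i <= k)%N.
Proof. by rewrite -ltnS /=. Qed.

Lemma Cell_bij : set_bij setT (@open_qcells X k Stage) (fun i : 'I_k.+1 => Cell (inject i)).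
Proof.
have ne i : (i <= k)%N -> exists x, Cell i x.
  move=> ik; have [l [Phi BS]] := bott_samelson_exists R (@entry_inj _ _ (lam i)).
  exact: (Cell_nonempty ik BS).
split.
- move=> i _ /=; have [i0|i0] := posnP i.
    have ii : inject i = ord0 by apply: val_inj.
    left; have [x Cx] := ne ord0 (leq0n k); exists x; first by rewrite Stage0.
    rewrite ii -Stage0; apply/seteqP; split=> [_ ->|y Sy]; first by rewrite Stage0.
    by apply: (Stage0_uniq Sy); rewrite Stage0.
  right; exists i.-1; first by rewrite /= -ltnS prednK.
  have ie : inject i = i.-1.+1 :> nat by rewrite prednK.
  exact: (Stage_diff ie (inject_le i)).
- move=> i j _ _ Cij; have [x Cx] := ne _ (inject_le i).
  have Cjx : Cell (inject j) x by rewrite -Cij.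
  have := Cell_eq (inject_le i) (inject_le j) Cx Cjx.
  by move=> /(congr1 val) ij; exact: val_inj.
move=> Y [[x Sx <-]|[e ek <-]].
  exists ord0 => //; rewrite (_ : inject ord0 = ord0); last exact: val_inj.
  rewrite -Stage0; apply/seteqP; split=> [y Sy|_ ->//].
  exact: Stage0_uniq.
have ek1 : (e.+1 < k.+1)%N by [].
by exists (Ordinal ek1) => //; apply/esym/(Stage_diff _ (inject_le _)).
Qed.

Lemma Cells_qcell_structure (r : 'I_k.+1 -> nat) :
  (forall i : 'I_k.+1, (r i %| c_ (inject i))%N) ->
  gives_qcell_structure R X
    (fun i : 'I_k.+1 => qcell R w (c_ (inject i)) (r i) (lam (inject i))).
Proof.
move=> r_dvd; exists k, Stage; split; first exact: qcell_structure_Stage.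
exists (fun i : 'I_k.+1 => Cell (inject i)); first exact: Cell_bij.
move=> i; have [l [Phi BS]] := bott_samelson_exists R (@entry_inj _ _ (lam (inject i))).
exact: (Cell_homeomorphic (inject_le i) BS (r_dvd i)).
Qed.

End Cells.

(** * The two q-cell structures *)

Section Applications.
Variables (R : realType) (n d : nat) (d_gt0 : (0 < d)%N).
Variables (w : 'I_n -> nat) (a : nat) (a_gt0 : (0 < a)%N).
Variables (m : nat) (lam : 'I_m.+1 -> schubert n d).
Hypotheses (lam_bij : bijective lam).
Hypothesis lam_mono : forall i j, schubert_le (lam i) (lam j) -> (i <= j)%N.
Local Notation C := (Cplx R).
Local Notation FR := (full_rank R n d).
Local Notation c_ i := (cnum lam w a i).
Implicit Types (i j k : 'I_m.+1).

Lemma Xtilde_inhabited k : exists A : FR, Xtilde lam k A.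
Proof.
have [l [Phi BS]] := bott_samelson_exists R (@entry_inj _ _ (lam k)).
pose v : 'I_l -> C := fun=> 0.
have v1 q : `|v q| <= 1 by rewrite normr0 ler01.
exists (mkfr (bs_rank BS v1)) => j kj; apply/eqP; apply: contraLR kj.
by move=> /(bs_supp BS v1)/cle_entryP/lam_mono; rewrite -leqNgt.
Qed.

Lemma rnum_dvd k i : (i <= k)%N -> (rnum lam w a k %| c_ i)%N.
Proof. by move=> ik; rewrite /rnum; exact: biggcdn_inf ik (dvdnn _). Qed.

Lemma rnum_gt0 k : (0 < rnum lam w a k)%N.
Proof. by rewrite (dvdn_gt0 _ (@rnum_dvd k ord0 _)) ?c_gt0. Qed.

Section Pluecker.
Variable k : 'I_m.+1.
Local Notation XT := (@Xtilde R n d m lam k).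

Definition pvec (A : FR) : 'rV[C]_k.+1 := \row_i mnr lam A (inject i).

Lemma Xtilde_eq0 (A : XT) : (forall i : 'I_k.+1, mnr lam (val A) (inject i) = 0) ->
  forall j, mnr lam (val A) j = 0.
Proof.
move=> A0 j; have [jk|kj] := leqP j k; last exact: (@set_valP _ XT A) kj.
by rewrite -(A0 (Ordinal (jk : (j < k.+1)%N))); congr (mnr _ _ _); exact: val_inj.
Qed.

Lemma pvec_neq0 (A : XT) : pvec (val A) \in nonzero_vec R k.
Proof.
apply/mem_set/negP => /eqP/rowP A0; have := nrm1_gt0 lam_bij (val A).
rewrite /nrm1 big1 ?ltxx// => j _; rewrite Xtilde_eq0 ?normr0// => i.
by have := A0 i; rewrite !mxE.
Qed.

Definition pluecker (A : XT) : nonzero_vec R k :=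
  exist (fun z => z \in nonzero_vec R k) _ (pvec_neq0 A).

Lemma pluecker_continuous : continuous pluecker.
Proof.
apply: continuous_to_set; apply: cont_mx => b i; under eq_fun do rewrite mxE.
apply: cont_mnr => p q; apply: cont_entry.
exact: (cont_comp (@continuous_val _ XT) (@continuous_val _ _)).
Qed.

(** Scalars for the weights [c / r] are the r-th powers of scalars for the weights [c], and every
    complex number has an r-th root. *)
Lemma wp_pi_pluecker (r : nat) (A B : XT) : (0 < r)%N ->
    (forall i, (i <= k)%N -> (r %| c_ i)%N) ->
  wp_pi (fun i : 'I_k.+1 => (c_ (inject i) %/ r)%N) (pluecker A) =
  wp_pi (fun i : 'I_k.+1 => (c_ (inject i) %/ r)%N) (pluecker B) <->
  exists2 t, t != 0 & related w a lam t (val A) (val B).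
Proof.
move=> r0 rc; have rci (i : 'I_k.+1) : (r %| c_ (inject i))%N.
  by apply: rc; rewrite -ltnS /=.
split=> [/eqmodP/asboolP[t t0 AB]|[t t0 AB]]; last first.
  apply/eqmodP/asboolP; exists (t ^+ r); first exact: expf_neq0.
  by move=> i; rewrite !mxE AB -exprM mulnC divnK.
have tE : (r.-root t) ^+ r = t by rewrite rootCK.
exists (r.-root t) => [|j].
  by apply: contraNneq t0 => r0'; rewrite -tE r0' expr0n gtn_eqF.
have [jk|kj] := leqP j k; last first.
  by rewrite (@set_valP _ XT A _ kj : mnr _ _ j = 0) (@set_valP _ XT B _ kj : mnr _ _ j = 0) mulr0.
have := AB (Ordinal (jk : (j < k.+1)%N)); rewrite !mxE.
rewrite (_ : inject _ = j); last exact: val_inj.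
by move=> ->; rewrite -{1}tE -exprM mulnC divnK ?rc.
Qed.

Lemma qcell_structure_WP : (1 <= k)%N ->
  let b := fun i : 'I_k.+1 => (c_ (inject i) %/ rnum lam w a k)%N in
  gives_qcell_structure R (wp_pi b @` PXtilde R lam k)
    (fun i : 'I_k.+1 => qcell R w (c_ (inject i)) (rnum lam w a k) (lam (inject i))).
Proof.
move=> _ b; have ik (i : 'I_k.+1) : (inject i <= k)%N by rewrite -ltnS /=.
pose Y := wp_pi b @` PXtilde R lam k.
have pY (A : XT) : wp_pi b (pluecker A) \in Y.
  apply/mem_set; exists (pluecker A) => //.
  exists (val A); first exact: (@set_valP _ XT A).
  by move=> i; rewrite mxE.
pose p (A : XT) : Y := exist (fun x => x \in Y) _ (pY A).
have [A0 XA0] := Xtilde_inhabited k.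
apply: (@Cells_qcell_structure R n d d_gt0 w a a_gt0 m lam lam_bij lam_mono k Y p
  (exist (fun A => A \in XT) A0 (mem_set XA0))).
- apply: (hausdorff_inj (@continuous_val _ _) val_inj); apply: wp_hausdorff => i.
  by rewrite divn_gt0 ?rnum_gt0// dvdn_leq ?c_gt0// rnum_dvd.
- apply: continuous_to_set; apply: (cont_comp pluecker_continuous).
  exact: pi_continuous.
- move=> x; have [z [A XA zA] zx] := @set_valP _ Y x.
  exists (exist (fun A => A \in XT) A (mem_set XA)); apply: val_inj => /=.
  rewrite -zx; congr (wp_pi b _); apply/val_inj/rowP => i.
  by rewrite zA mxE.
- move=> A B; rewrite -(wp_pi_pluecker A B (rnum_gt0 k) (@rnum_dvd k)).
  by split=> [/(congr1 val)|E]; last exact: val_inj.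
- by move=> i; exact: rnum_dvd.
Qed.

End Pluecker.

(** The condition [t ^+ a = \det T] supplies the summand [a] of [c_j]. Conversely, proportional
    minors produce [T], and one nonzero minor reads off its determinant. *)
Lemma weq_related (A B : FR) : \pi_(WGr R d w a) A = \pi_(WGr R d w a) B <->
  exists2 t, t != 0 & related w a lam t A B.
Proof.
split=> [/eqmodP/asboolP[T [t [uT t0 tT BE]]]|[t t0 AB]].
  exists t => // j; have BE' : val B = val (wscale w t A) *m T by rewrite val_wscale.
  by rewrite (mnr_mulr lam j BE') mnr_wscale// -tT /cnum exprD mulrC mulrA.
have ta : t ^+ a != 0 by exact: expf_neq0.
have BC j : mnr lam B j = t ^+ a * mnr lam (wscale w t A) j.
  by rewrite AB mnr_wscale// /cnum exprD mulrA.
have [l Cl] := rank_pl (full_rankP (wscale w t A)).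
have [j jl] := lam_surj lam_bij l; rewrite -jl in Cl.
have BC' l' : pl (val B) (entry l') = t ^+ a * pl (val (wscale w t A)) (entry l').
  by have [j' <-] := lam_surj lam_bij l'; exact: BC.
have /pi_GrP[T uT BE] := pi_Gr_nrm Cl ta BC'.
apply/eqmodP/asboolP; exists T, t; split=> //; last by rewrite BE val_wscale.
have := mnr_mulr lam j BE; rewrite BC mulrC.
by move=> /mulfI; apply.
Qed.

Lemma qcell_structure_WGr : gives_qcell_structure R (WGr R d w a)
  (fun i => qcell R w (c_ i) (rnum lam w a i) (lam i)).
Proof.
have [A0 XA0] := Xtilde_inhabited ord_max.
have XT (A : FR) : Xtilde lam ord_max A.
  by move=> j; rewrite ltnNge -ltnS ltn_ord.
pose toXT (A : FR) : @Xtilde R n d m lam ord_max :=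
  exist (fun A => A \in @Xtilde R n d m lam ord_max) A (mem_set (XT A)).
pose p (A : @Xtilde R n d m lam ord_max) : WGr R d w a := \pi_(WGr R d w a) (val A).
have injE (i : 'I_m.+1) : inject (k := ord_max) i = i by exact: val_inj.
pose Y i : topologicalType := qcell R w (c_ i) (rnum lam w a i) (lam i).
pose Y' (i : 'I_(@ord_max m).+1) : topologicalType := Y (inject i).
have YE : Y = Y' by apply/funext => i; rewrite /Y' injE.
rewrite -[X in gives_qcell_structure _ _ X]/Y YE.
apply: (@Cells_qcell_structure R n d d_gt0 w a a_gt0 m lam lam_bij lam_mono ord_max
  _ p (toXT A0)).
(* Hausdorffness comes from the continuous injection by Pluecker coordinates into a weighted
   projective space, with divisor 1. *)
- pose b (i : 'I_(@ord_max m).+1) := (c_ (inject i) %/ 1)%N.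
  have wpE (A B : FR) := wp_pi_pluecker (k := ord_max) (toXT A) (toXT B) (ltn0Sn 0)
    (fun i _ => dvd1n (c_ i)).
  apply: (@hausdorff_inj _ _ ((fun A => wp_pi b (pluecker (toXT A))) \o
    (repr : WGr R d w a -> FR))).
  + apply: repr_comp_continuous.
      apply: (cont_comp (g := fun A => wp_pi b (pluecker A))); last first.
        by apply: (cont_comp (@pluecker_continuous ord_max)); exact: pi_continuous.
      by apply: continuous_to_set => x; exact: cvg_id.
    by move=> A B /eqP/weq_related AB; apply/eqP/wpE.
  + by move=> q q' /wpE/weq_related; rewrite !reprK.
  + by apply: wp_hausdorff => i; rewrite /b divn1 c_gt0.
- by apply: (cont_comp (@continuous_val _ _)); exact: pi_continuous.
- by move=> q; exists (toXT (repr q)); rewrite /p /= reprK.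
- by move=> A B; exact: weq_related.
- by move=> i; exact: rnum_dvd.
Qed.

End Applications.

Theorem theorem3p4 (R : realType) (d n : nat) (hd : (1 <= d)%N) (hdn : (d < n)%N)
    (w : 'I_n -> nat) (a : nat) (ha : (1 <= a)%N)
    (m : nat) (hm : m = ('C(n, d) - 1)%N)
    (lam : 'I_m.+1 -> schubert n d) (lam_bij : bijective lam)
    (lam_mono : forall i j, schubert_le (lam i) (lam j) -> (i <= j)%N) :
  (forall k : 'I_m.+1, (1 <= k)%N ->
     let b := fun i : 'I_k.+1 =>
       (cnum lam w a (inject i) %/ rnum lam w a k)%N in
     gives_qcell_structure R (wp_pi b @` PXtilde R lam k)
       (fun i : 'I_k.+1 =>
          qcell R w (cnum lam w a (inject i)) (rnum lam w a k)
            (lam (inject i)))) /\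
  gives_qcell_structure R (WGr R d w a)
    (fun i : 'I_m.+1 => qcell R w (cnum lam w a i) (rnum lam w a i) (lam i)).
Proof.
split=> [k k1|]; [exact: qcell_structure_WP|exact: qcell_structure_WGr].
Qed.
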